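(* Let $m,n\ge 1$ be integers. The pure braid group $P_{m,n}\le B_{m+n}$ has a presentation with generators the pure braids $a_{ij}$ for $i\in\{1,\ldots,m+n-1\}$, $j\in\{m+1,\ldots,m+n\}$, $i<j$, and defining relations the following (for all indices such that every $a_{\cdot\cdot}$ occurring is one of these generators): \begin{align*} (P_1)\quad & a_{ij}^{-1}a_{rs}a_{ij}=a_{rs} && \text{if } i<j<r<s \text{ or } r<i<j<s,\\ (P_2)\quad & a_{ij}^{-1}a_{js}a_{ij}=a_{is}a_{js}a_{is}^{-1} && \text{if } i<j<s,\\ (P_3)\quad & a_{ij}^{-1}a_{is}a_{ij}=a_{is}a_{js}a_{is}a_{js}^{-1}a_{is}^{-1} && \text{if } i<j<s,\\ (P_4)\quad & a_{ij}^{-1}a_{rs}a_{ij}=a_{is}a_{js}a_{is}^{-1}a_{js}^{-1}\,a_{rs}\,a_{js}a_{is}a_{js}^{-1}a_{is}^{-1} && \text{if } i<r<j<s. \end{align*}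
   Context: $B_k$ denotes the classical Artin braid group on $k$ strands, with standard generators $\sigma_1,\ldots,\sigma_{k-1}$, relations $\sigma_i\sigma_j=\sigma_j\sigma_i$ for $|i-j|>1$ and $\sigma_i\sigma_{i+1}\sigma_i=\sigma_{i+1}\sigma_i\sigma_{i+1}$, and product given by concatenation. $P_k\lhd B_k$ is the pure braid group, i.e. the kernel of the natural map $B_k\to S_k$. $B_{m,n}\le B_{m+n}$ is the subgroup of all braids on $m+n$ strands such that, if the last $n$ strands are removed, what is left is the identity braid on the first $m$ strands (in particular the first $m$ strands begin and end at the positions $1,\ldots,m$, strand $i$ ending at position $i$). $P_{m,n}:=B_{m,n}\cap P_{m+n}$. For $1\le i<j\le m+n$, the element $a_{ij}\in P_{m+n}$ is $$a_{ij}=\sigma_i^{-1}\sigma_{i+1}^{-1}\cdots\sigma_{j-2}^{-1}\,\sigma_{j-1}^{2}\,\sigma_{j-2}\cdots\sigma_{i+1}\sigma_i=\sigma_{j-1}\sigma_{j-2}\cdots\sigma_{i+1}\,\sigma_i^{2}\,\sigma_{i+1}^{-1}\cdots\sigma_{j-2}^{-1}\sigma_{j-1}^{-1}.$$ *)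

(* Defs.v *)
From HB Require Import structures.
From mathcomp Require Import all_boot all_fingroup.
From mathcomp Require Import generic_quotient boolp classical_sets zify.

Set Implicit Arguments.
Unset Strict Implicit.
Unset Printing Implicit Defensive.

Local Open Scope quotient_scope.
Local Open Scope group_scope.

(* MathComp has no free groups: the group presented by generators X and a set
   of relations R is built as the formal group expressions over X modulo the
   least congruence that contains the group axioms and R. *)
Inductive gexpr (X : Type) : Type :=
| Gen of X
| One
| Inv of gexpr X
| Mul of gexpr X & gexpr X.
Arguments One {X}.

Declare Scope gexpr_scope.
Delimit Scope gexpr_scope with X.
Bind Scope gexpr_scope with gexpr.
Notation "1" := One : gexpr_scope.
Notation "x * y" := (Mul x y) : gexpr_scope.
Notation "x ^-1" := (Inv x) : gexpr_scope.

HB.instance Definition _ (X : Type) := gen_eqMixin (gexpr X).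
HB.instance Definition _ (X : Type) := gen_choiceMixin (gexpr X).

Section Presentation.
Variables (X : Type) (R : gexpr X -> gexpr X -> Prop).

Inductive pres_eq : gexpr X -> gexpr X -> Prop :=
| pres_rel u v of R u v : pres_eq u v
| pres_refl u : pres_eq u u
| pres_sym u v of pres_eq u v : pres_eq v u
| pres_trans u v w of pres_eq u v & pres_eq v w : pres_eq u w
| pres_mul u u' v v' of pres_eq u u' & pres_eq v v' :
    pres_eq (u * v)%X (u' * v')%X
| pres_inv u u' of pres_eq u u' : pres_eq u^-1%X u'^-1%X
| pres_mulA u v w : pres_eq (u * (v * w))%X (u * v * w)%X
| pres_mul1 u : pres_eq (1 * u)%X u
| pres_mulV u : pres_eq (u^-1 * u)%X 1%X.

Definition pres_eqb (u v : gexpr X) : bool := `[< pres_eq u v >].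

Lemma pres_eqb_refl : reflexive pres_eqb.
Proof. by move=> u; apply/asboolP/pres_refl. Qed.

Lemma pres_eqb_sym : symmetric pres_eqb.
Proof. by move=> u v; apply/asboolP/asboolP => /pres_sym. Qed.

Lemma pres_eqb_trans : transitive pres_eqb.
Proof.
move=> v u w /asboolP uv /asboolP vw; apply/asboolP; exact: pres_trans uv vw.
Qed.

Canonical pres_equiv :=
  EquivRel pres_eqb pres_eqb_refl pres_eqb_sym pres_eqb_trans.

Definition pres : Type := {eq_quot pres_equiv}.
HB.instance Definition _ := Choice.on pres.
HB.instance Definition _ := EqQuotient.on pres.

Definition pres_class (u : gexpr X) : pres := \pi_pres u.

Lemma pres_classP u v : reflect (pres_eq u v) (pres_class u == pres_class v).
Proof. by rewrite eqmodE; apply: asboolP. Qed.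

Lemma pres_class_eq u v : pres_eq u v -> pres_class u = pres_class v.
Proof. by move=> uv; apply/eqP/pres_classP. Qed.

Lemma pres_class_inj u v : pres_class u = pres_class v -> pres_eq u v.
Proof. by move=> /eqP/pres_classP. Qed.

Lemma pres_reprK (b : pres) : pres_class (repr b) = b.
Proof. exact: reprK. Qed.

Definition pres_one_op : pres := pres_class 1%X.
Definition pres_inv_op : pres -> pres :=
  locked (fun b => pres_class (repr b)^-1%X).
Definition pres_mul_op : pres -> pres -> pres :=
  locked (fun b c => pres_class (repr b * repr c)%X).

Lemma pres_mul_opE u v :
  pres_mul_op (pres_class u) (pres_class v) = pres_class (u * v)%X.
Proof.
rewrite /pres_mul_op -lock.
by apply: pres_class_eq; apply: pres_mul; apply: pres_class_inj;
  rewrite pres_reprK.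
Qed.

Lemma pres_inv_opE u : pres_inv_op (pres_class u) = pres_class u^-1%X.
Proof.
rewrite /pres_inv_op -lock.
by apply: pres_class_eq; apply: pres_inv; apply: pres_class_inj;
  rewrite pres_reprK.
Qed.

Lemma pres_opA : associative pres_mul_op.
Proof.
move=> b c d; rewrite -(pres_reprK b) -(pres_reprK c) -(pres_reprK d).
rewrite !pres_mul_opE; exact/pres_class_eq/pres_mulA.
Qed.

Lemma pres_op1 : left_id pres_one_op pres_mul_op.
Proof.
move=> b; rewrite -(pres_reprK b) pres_mul_opE.
exact/pres_class_eq/pres_mul1.
Qed.

Lemma pres_opV : left_inverse pres_one_op pres_inv_op pres_mul_op.
Proof.
move=> b; rewrite -(pres_reprK b) pres_inv_opE pres_mul_opE.
exact/pres_class_eq/pres_mulV.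
Qed.

Lemma pres_opVr : right_inverse pres_one_op pres_inv_op pres_mul_op.
Proof.
move=> b; rewrite -[LHS]pres_op1 -{1}(pres_opV (pres_inv_op b)).
by rewrite -pres_opA (pres_opA _ b) pres_opV pres_op1 pres_opV.
Qed.

Lemma pres_op1r : right_id pres_one_op pres_mul_op.
Proof. by move=> b; rewrite -(pres_opV b) pres_opA pres_opVr pres_op1. Qed.

HB.instance Definition _ := isGroup.Build pres
  pres_opA pres_op1 pres_op1r pres_opV pres_opVr.

Lemma pres_classM u v : pres_class (u * v)%X = pres_class u * pres_class v.
Proof. by rewrite -pres_mul_opE. Qed.

Lemma pres_classV u : pres_class u^-1%X = (pres_class u)^-1.
Proof. by rewrite -pres_inv_opE. Qed.

Lemma pres_class1 : pres_class 1%X = 1.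
Proof. by []. Qed.

Definition pres_gen (x : X) : pres := pres_class (Gen x).

Section Lift.
Variables (G : groupType) (f : X -> G).

Fixpoint geval (u : gexpr X) : G :=
  match u with
  | Gen x => f x
  | One => 1
  | Inv u => (geval u)^-1
  | Mul u v => geval u * geval v
  end.

Definition respects_relations : Prop := forall u v, R u v -> geval u = geval v.

Hypothesis fR : respects_relations.

Lemma geval_pres_eq u v : pres_eq u v -> geval u = geval v.
Proof.
elim=> {u v} //=.
- by move=> u v w _ -> _ ->.
- by move=> u u' v v' _ -> _ ->.
- by move=> u u' _ ->.
- by move=> u v w; rewrite mulgA.
- by move=> u; rewrite mul1g.
- by move=> u; rewrite mulVg.
Qed.

Definition pres_lift of respects_relations := fun b : pres => geval (repr b).

Lemma pres_liftE u : pres_lift fR (pres_class u) = geval u.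
Proof.
by apply: geval_pres_eq; apply: pres_class_inj; rewrite pres_reprK.
Qed.

Lemma pres_lift_gen x : pres_lift fR (pres_gen x) = f x.
Proof. exact: pres_liftE. Qed.

Lemma pres_liftM : {morph pres_lift fR : b c / b * c}.
Proof.
move=> b c; rewrite -(pres_reprK b) -(pres_reprK c) -pres_classM.
by rewrite !pres_liftE.
Qed.

Lemma pres_lift1 : pres_lift fR 1 = 1.
Proof. by rewrite -pres_class1 pres_liftE. Qed.

HB.instance Definition _ :=
  isUMagmaMorphism.Build pres G (pres_lift fR) (pres_lift1, pres_liftM).

End Lift.
End Presentation.

(* H is the image of the presented group under the morphism extending x, and
   that morphism is injective. *)
Definition has_presentation (G : groupType) (H : set G) (X : Type) (x : X -> G)
    (R : gexpr X -> gexpr X -> Prop) : Prop :=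
  exists f : UMagmaMorphism.type (pres R) G,
    [/\ forall g, f (pres_gen R g) = x g, injective f & range f = H].

(* Strands, positions and generators are numbered from 0: Gen i is the braid
   crossing the positions i and i.+1. *)
Inductive braid_rel (k : nat) : gexpr 'I_k.-1 -> gexpr 'I_k.-1 -> Prop :=
| braid_comm (i j : 'I_k.-1) of (i.+1 < j)%N || (j.+1 < i)%N :
    braid_rel (Gen i * Gen j) (Gen j * Gen i)
| braid_braid (i j : 'I_k.-1) of j = i.+1 :> nat :
    braid_rel (Gen i * Gen j * Gen i) (Gen j * Gen i * Gen j).

Definition braid (k : nat) : groupType := pres (@braid_rel k).

(* Only the values i < k.-1 are meaningful; the others give 1. *)
Definition sigma (k i : nat) : braid k :=
  if insub i : option 'I_k.-1 is Some i' then pres_gen (@braid_rel k) i' else 1.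

Lemma sigma_gen (k : nat) (i : 'I_k.-1) :
  sigma k i = pres_gen (@braid_rel k) i.
Proof. by rewrite /sigma valK. Qed.

Lemma sigma_comm (k i j : nat) : (i.+1 < j)%N ->
  sigma k i * sigma k j = sigma k j * sigma k i.
Proof.
move=> ij; rewrite /sigma.
case: insubP => [i' _ Hi|_]; last by rewrite mul1g mulg1.
case: insubP => [j' _ Hj|_]; last by rewrite mul1g mulg1.
rewrite -!pres_classM; apply/pres_class_eq/pres_rel/braid_comm.
by rewrite Hi Hj ij.
Qed.

Lemma sigma_braid (k i : nat) : (i.+2 < k)%N ->
  sigma k i * sigma k i.+1 * sigma k i
  = sigma k i.+1 * sigma k i * sigma k i.+1.
Proof.
case: k => [|k] // ik.
have Hi : (i < k.+1.-1)%N by apply: ltnW.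
have Hj : (i.+1 < k.+1.-1)%N by [].
have := sigma_gen (Ordinal Hi); have := sigma_gen (Ordinal Hj) => /= -> ->.
rewrite /pres_gen -!pres_classM; apply/pres_class_eq/pres_rel.
exact: braid_braid.
Qed.

Section Positions.
Variable k : nat.
Implicit Types (i j : 'I_k.-1) (A : {set 'I_k}).

Lemma ord_hi_proof i : (i.+1 < k)%N.
Proof. by case: k i => [|n] [i Hi]. Qed.

Definition ord_lo i : 'I_k := Ordinal (ltnW (ord_hi_proof i)).
Definition ord_hi i : 'I_k := Ordinal (ord_hi_proof i).

Definition swap i : {perm 'I_k} := tperm (ord_lo i) (ord_hi i).

Lemma swap_fix i (p : 'I_k) :
  p != i :> nat -> p != i.+1 :> nat -> swap i p = p.
Proof. by move=> pi pSi; rewrite /swap tpermD // -val_eqE /= eq_sym. Qed.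

Lemma swapK i : involutive (swap i).
Proof. exact: tpermK. Qed.

Lemma swap_comm i j : (i.+1 < j)%N -> swap i * swap j = swap j * swap i.
Proof.
move=> ij; apply/esym/commgP/conjg_fixP.
by rewrite /swap tpermJ -/(swap i) !swap_fix //=; lia.
Qed.

Lemma swap_braid i j : j = i.+1 :> nat ->
  swap i * swap j * swap i = swap j * swap i * swap j.
Proof.
move=> ij.
have Eij : ord_lo j = ord_hi i by apply: val_inj.
have conjS l (t : {perm 'I_k}) : swap l * t * swap l = t ^ swap l.
  by rewrite conjgE -mulgA /swap tpermV.
rewrite !conjS {1}/swap {2}/swap !tpermJ Eij tpermR -Eij tpermL.
by rewrite swap_fix ?[swap j _]swap_fix //=; lia.
Qed.

Lemma swap_respects : respects_relations (@braid_rel k) swap.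
Proof.
move=> u v []{u v} i j /=; last exact: swap_braid.
by case/orP=> [/swap_comm|/swap_comm ->].
Qed.

End Positions.

(* braid_perm b sends the initial position of each strand to its final one. *)
Definition braid_perm (k : nat) : braid k -> {perm 'I_k} :=
  pres_lift (@swap_respects k).
HB.instance Definition _ (k : nat) :=
  UMagmaMorphism.copy (@braid_perm k) (pres_lift (@swap_respects k)).

Definition pure_braid (k : nat) : set (braid k) :=
  [set b | braid_perm b = 1]%classic.
Arguments pure_braid k : clear implicits.

Section KeepStrands.
Variable k : nat.
Implicit Types (i j : 'I_k.-1) (A : {set 'I_k}) (u v : gexpr 'I_k.-1).

Definition rank A (p : nat) : nat := #|[set q in A | (q < p)%N]|.

(* The braid on m = #|A| strands left of u when only the strands whose initial
   positions form A are kept: a crossing survives if both its strands are kept,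
   and then rank A p, the number of kept strands to the left of its position p,
   is its new index. The letter after u meets the kept strands at the positions
   geval swap u @: A. *)
Fixpoint keep_expr (m : nat) A u : braid m :=
  match u with
  | Gen i => if (ord_lo i \in A) && (ord_hi i \in A)
             then sigma m (rank A (ord_lo i)) else 1
  | One => 1
  | Inv u => (keep_expr m ((geval (@swap k) u)^-1 @: A) u)^-1
  | Mul u v => keep_expr m A u * keep_expr m (geval (@swap k) u @: A) v
  end.

Lemma rankS A (p : 'I_k) : rank A p.+1 = (rank A p + (p \in A))%N.
Proof.
rewrite /rank; case: (boolP (p \in A)) => pA.
  rewrite (_ : [set q in A | _] = p |: [set q in A | (q < p)%N]).
    by rewrite cardsU1 inE ltnn andbF addnC.
  apply/setP => q; rewrite !inE ltnS leq_eqVlt val_eqE.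
  by case: eqVneq => [->|]; rewrite ?pA.
rewrite addn0; congr #|pred_of_set _|; apply/setP => q.
rewrite !inE ltnS leq_eqVlt val_eqE.
by case: eqVneq => [->|] //; rewrite (negPf pA).
Qed.

Lemma rank_leq A (p q : nat) : (p <= q)%N -> (rank A p <= rank A q)%N.
Proof.
move=> pq; rewrite /rank; apply/subset_leq_card/fintype.subsetP => x.
rewrite !inE => /andP[-> xp].
exact: leq_trans xp pq.
Qed.

Lemma rank_max A p : (rank A p <= #|A|)%N.
Proof.
rewrite /rank; apply/subset_leq_card/fintype.subsetP => x.
by rewrite !inE => /andP[].
Qed.

Lemma in_swap i A x : (x \in swap i @: A) = (swap i x \in A).
Proof. by rewrite -{1}[x](swapK i) mem_imset //; apply: perm_inj. Qed.

Lemma swap_lo i : swap i (ord_lo i) = ord_hi i.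
Proof. exact: tpermL. Qed.

Lemma swap_hi i : swap i (ord_hi i) = ord_lo i.
Proof. exact: tpermR. Qed.

Lemma rank_swap i A p : p != i.+1 -> rank (swap i @: A) p = rank A p.
Proof.
move=> pi; rewrite /rank -[RHS](card_imset _ (@perm_inj _ (swap i))).
congr #|pred_of_set _|; apply/setP => q; rewrite !inE !in_swap !inE.
congr (_ && _); case: (tpermP (ord_lo i) (ord_hi i) q) => [->|->|] //=; lia.
Qed.

Lemma keep_comm m A i j : (i.+1 < j)%N ->
  keep_expr m A (Gen i * Gen j) = keep_expr m A (Gen j * Gen i).
Proof.
move=> ij /=; rewrite !in_swap !rank_swap /=; try lia.
rewrite !(@swap_fix _ i) /=; try lia.
rewrite !(@swap_fix _ j) /=; try lia.
case: ifP => [/andP[iA iA']|_]; last by rewrite mul1g mulg1.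
case: ifP => [/andP[jA jA']|_]; last by rewrite mul1g mulg1.
apply: sigma_comm.
have := rankS A (ord_lo i); have := rankS A (ord_hi i).
have := rank_leq A (ij : i.+2 <= j)%N; rewrite iA iA' /=; lia.
Qed.

Lemma keep_braid A i j : j = i.+1 :> nat ->
  keep_expr #|A| A (Gen i * Gen j * Gen i)
  = keep_expr #|A| A (Gen j * Gen i * Gen j).
Proof.
move=> ij /=.
have Eij : ord_lo j = ord_hi i by apply: val_inj.
have Fij : swap j (ord_lo i) = ord_lo i by apply: swap_fix => /=; lia.
have Fji : swap i (ord_hi j) = ord_hi j by apply: swap_fix => /=; lia.
have Ej := swap_lo j; rewrite Eij in Ej.
have Ej' := swap_hi j; rewrite Eij in Ej'.
have imM (s t : {perm 'I_k}) : (s * t) @: A = t @: (s @: A).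
  by rewrite -imset_comp; apply: eq_imset => x; rewrite permM.
rewrite !imM !Eij !in_swap !(swap_lo, swap_hi, Ej, Ej', Fij, Fji).
have R1 B : rank B i.+1 = (rank B i + (ord_lo i \in B))%N := rankS B (ord_lo i).
have R2 : rank A i.+2 = (rank A i.+1 + (ord_hi i \in A))%N.
  exact: (rankS A (ord_hi i)).
have R3 : rank A i.+3 = (rank A i.+2 + (ord_hi j \in A))%N.
  by rewrite -ij; apply: (rankS A (ord_hi j)).
rewrite /= !ij !R1 !in_swap !(swap_lo, swap_hi, Ej, Ej', Fij, Fji) Eij.
rewrite !rank_swap /=; try lia.
have := rank_max A i.+3; rewrite R3 R2 R1.
case: (ord_lo i \in A); case: (ord_hi i \in A); case: (ord_hi j \in A) => /= le;
  rewrite ?mul1g ?mulg1 ?addn0 ?addn1 //.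
by apply: sigma_braid; lia.
Qed.

Lemma keep_pres_eq m A u v : #|A| = m -> pres_eq (@braid_rel k) u v ->
  keep_expr m A u = keep_expr m A v.
Proof.
move=> Am uv; elim: uv A Am => {u v}.
- by move=> u v [] i j ij A <-;
    [case/orP: ij => /keep_comm ->|apply: keep_braid].
- by [].
- by move=> u v _ IH A /IH.
- by move=> u v w _ IH1 _ IH2 A Am; rewrite IH1 ?IH2.
- move=> u u' v v' uu' IHu _ IHv A Am /=.
  rewrite IHu // (geval_pres_eq (@swap_respects k) uu') IHv //.
  by rewrite card_imset //; apply: perm_inj.
- move=> u u' uu' IHu A Am /=.
  rewrite (geval_pres_eq (@swap_respects k) uu') IHu //.
  by rewrite card_imset //; apply: perm_inj.
- move=> u v w A Am /=; rewrite mulgA; congr (_ * _ * keep_expr _ _ _).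
  by rewrite -imset_comp; apply: eq_imset => x; rewrite /= permM.
- move=> u A Am /=; rewrite mul1g; congr keep_expr; rewrite -[RHS]imset_id.
  by apply: eq_imset => x; rewrite perm1.
- by move=> u A Am /=; rewrite mulVg.
Qed.

Definition keep_strands (m : nat) A (b : braid k) : braid m :=
  keep_expr m A (repr b).

Lemma keep_strandsE m A u : #|A| = m ->
  keep_strands m A (pres_class (@braid_rel k) u) = keep_expr m A u.
Proof.
by move=> Am; apply: keep_pres_eq => //; apply: pres_class_inj;
  rewrite pres_reprK.
Qed.

End KeepStrands.

Lemma card_first_strands (m n : nat) : #|[set p : 'I_(m + n) | (p < m)%N]| = m.
Proof.
rewrite -[RHS]card_ord -(card_imset _ (@lshift_inj m n)).
congr #|pred_of_set _|; apply/setP => p; rewrite inE.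
apply/idP/imsetP => [pm|[q _ ->] //]; last exact: (ltn_ord q).
by exists (Ordinal pm) => //; apply: val_inj.
Qed.

Definition remove_last (m n : nat) : braid (m + n) -> braid m :=
  keep_strands m [set p : 'I_(m + n) | (p < m)%N].

Definition mixed_braid (m n : nat) : set (braid (m + n)) :=
  [set b | (forall p : 'I_(m + n), (p < m)%N -> braid_perm b p = p)
           /\ remove_last b = 1]%classic.
Arguments mixed_braid m n : clear implicits.

Definition mixed_pure_braid (m n : nat) : set (braid (m + n)) :=
  (mixed_braid m n `&` pure_braid (m + n))%classic.
Arguments mixed_pure_braid m n : clear implicits.

Definition pure_gen (k i j : nat) : braid k :=
  (\prod_(l <- index_iota i j.-1) (sigma k l)^-1) * sigma k j.-1 ^+ 2
  * (\prod_(l <- rev (index_iota i j.-1)) sigma k l).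

Lemma conj_braid (G : groupType) (s : nat -> G) (i d : nat) :
  (forall p q, (p.+1 < q)%N -> s p * s q = s q * s p) ->
  (forall p, (p < i + d)%N -> s p * s p.+1 * s p = s p.+1 * s p * s p.+1) ->
  (\prod_(l <- index_iota i (i + d)) (s l)^-1) * s (i + d)%N ^+ 2
    * (\prod_(l <- rev (index_iota i (i + d))) s l)
  = (\prod_(l <- rev (index_iota i.+1 (i + d).+1)) s l) * s i ^+ 2
    * (\prod_(l <- index_iota i.+1 (i + d).+1) (s l)^-1).
Proof.
move=> sC; have prodV r :
    \prod_(l <- r) (s l)^-1 = (\prod_(l <- rev r) s l)^-1.
  elim: r => [|l r IH]; first by rewrite !big_nil invg1.
  by rewrite rev_cons -cats1 big_cat big_seq1 big_cons invgM IH.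
have iotaS p q : (p < q)%N -> index_iota p q = p :: index_iota p.+1 q.
  by move=> pq; rewrite /index_iota -(subnSK pq).
have revS p q : (p < q)%N -> \prod_(l <- rev (index_iota p q)) s l
    = (\prod_(l <- rev (index_iota p.+1 q)) s l) * s p.
  by move=> pq; rewrite iotaS // rev_cons -cats1 big_cat big_seq1.
rewrite !prodV; elim: d i => [|d IH] i sB.
  by rewrite addn0 /index_iota !subnn /= !big_nil invg1 !(mul1g, mulg1).
have conjM (x y z : G) :
    (x * y)^-1 * z * (x * y) = y^-1 * (x^-1 * z * x) * y.
  by rewrite invgM !mulgA.
rewrite !addnS (revS i) ?conjM; last lia.
have := IH i.+1; rewrite addSn => ->; last by move=> p pd; apply: sB; lia.
rewrite (revS i.+1); last lia.
set Q := \prod_(l <- _) _.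
have cQ : s i * Q = Q * s i.
  rewrite /Q big_seq; apply: (big_ind (fun x => s i * x = x * s i)).
  - by rewrite mul1g mulg1.
  - by move=> x y xC yC; rewrite mulgA xC -mulgA yC mulgA.
  - by move=> l; rewrite mem_rev mem_index_iota => /andP[il _]; apply: sC.
have := sB i; move: (s i) (s i.+1) cQ => x y cQ xyx.
have yx : y ^ x = x ^ y^-1.
  rewrite !conjgE invgK; apply: (mulgI x); apply: (mulIg y).
  by rewrite !mulgA mulgV mul1g mulgKV xyx //; lia.
have conjE (u v : G) : v * u * v^-1 = u ^ v^-1 by rewrite conjgE invgK mulgA.
rewrite conjE -mulgA -conjgE conjE -conjgM.
rewrite (_ : Q^-1 * x = x * Q^-1); last first.
  by apply: (mulgI Q); rewrite mulgA mulgV mul1g mulgA -cQ mulgK.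
by rewrite conjgM conjXg yx -conjXg -conjgM invgM.
Qed.

Lemma pure_genE (k i j : nat) : (i < j < k)%N ->
  pure_gen k i j
  = (\prod_(l <- rev (index_iota i.+1 j)) sigma k l) * sigma k i ^+ 2
    * (\prod_(l <- index_iota i.+1 j) (sigma k l)^-1).
Proof.
case/andP=> ij jk; have [d dE] : exists d, j = (i + d).+1.
  by exists (j - i.+1)%N; lia.
rewrite /pure_gen dE; apply: conj_braid => [p q|p pd]; first exact: sigma_comm.
by apply: sigma_braid; lia.
Qed.

(* The pairs i < j with j among the last n strands m, ..., m + n - 1. *)
Definition is_mixed_index (m n : nat) (p : 'I_(m + n) * 'I_(m + n)) : bool :=
  (p.1 < p.2)%N && (m <= p.2)%N.

Definition mixed_index (m n : nat) : Type := {p | @is_mixed_index m n p}.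

Definition mixed_gen (m n : nat) (p : mixed_index m n) : braid (m + n) :=
  pure_gen (m + n) (val p).1 (val p).2.

Section MixedRelations.
Variables (m n : nat).
Implicit Types i j r s : 'I_(m + n).

Definition mixed_letter i j (ij : is_mixed_index (i, j)) :
    gexpr (mixed_index m n) :=
  Gen (exist (@is_mixed_index m n) (i, j) ij).
Local Notation a := mixed_letter.

Inductive mixed_rel :
    gexpr (mixed_index m n) -> gexpr (mixed_index m n) -> Prop :=
| mixed_rel1 i j r s (ij : is_mixed_index (i, j)) (rs : is_mixed_index (r, s))
    of [&& i < j, j < r & r < s]%N || [&& r < i, i < j & j < s]%N :
    mixed_rel ((a ij)^-1 * a rs * a ij) (a rs)
| mixed_rel2 i j s (ij : is_mixed_index (i, j)) (js : is_mixed_index (j, s))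
    (is_ : is_mixed_index (i, s)) of (i < j < s)%N :
    mixed_rel ((a ij)^-1 * a js * a ij) (a is_ * a js * (a is_)^-1)
| mixed_rel3 i j s (ij : is_mixed_index (i, j)) (js : is_mixed_index (j, s))
    (is_ : is_mixed_index (i, s)) of (i < j < s)%N :
    mixed_rel ((a ij)^-1 * a is_ * a ij)
              (a is_ * a js * a is_ * (a js)^-1 * (a is_)^-1)
| mixed_rel4 i j r s (ij : is_mixed_index (i, j)) (rs : is_mixed_index (r, s))
    (is_ : is_mixed_index (i, s)) (js : is_mixed_index (j, s))
    of [&& i < r, r < j & j < s]%N :
    mixed_rel ((a ij)^-1 * a rs * a ij)
              (a is_ * a js * (a is_)^-1 * (a js)^-1 * a rs
               * a js * a is_ * (a js)^-1 * (a is_)^-1).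

End MixedRelations.

(* Main.v *)
From HB Require Import structures.
Require Import Defs.
From mathcomp Require Import all_boot all_fingroup boolp classical_sets zify.

(* Let A_i = a_(i,k) be the generators that involve the last of k+1 strands.
   Conjugation by sigma_l with l+1 < k acts on them by Artin's automorphism
   A_l -> A_l A_(l+1) A_l^-1, A_(l+1) -> A_l; as a_ij is a word in the sigma_l,
   this gives (P1)-(P4). Together with
     b = u c sigma_(k-1) ... sigma_p,   u in <A_0, ..., A_(k-1)>, c in B_k,
   valid for every braid b, it shows that <A_0, ..., A_(k-1)> is the kernel of
   the removal of the last strand, hence by induction that the a_ij generate.
   The A_i are free, because the action of B_(k+1) on the right cosets of B_k
   can be written down on pairs (p, w) with w in an abstract free group, where
   A_i multiplies w by x_i. Finally (P1)-(P4) write any word in the a_ij as a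
   word in the A_i times a word in the a_ij with j < k, in the presented group
   as well as in B_(k+1); removing the last strand gives injectivity by
   induction on k. *)

Set Implicit Arguments.
Unset Strict Implicit.
Unset Printing Implicit Defensive.

Local Open Scope group_scope.

(** * The relations *)

Ltac gnorm := rewrite ?conjgE ?expgS ?expg0
  ?(invgM, invgK, invg1, mulg1, mul1g, mulgA, mulgK, mulgVK, mulgV, mulVg).

Lemma conjg_sandwich (G : groupType) (x y z : G) :
  (x^-1 * y * x) ^ z = (x ^ z)^-1 * y ^ z * x ^ z.
Proof. by rewrite !conjMg conjVg. Qed.

(** With [s] the braid generators, this braid carries the strand at position [j] to position [i];
    a_ij is the conjugate of sigma_(j-1)^2 by [desc s i j.-1]. *)
Definition desc (G : groupType) (s : nat -> G) (i j : nat) : G :=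
  \prod_(l <- rev (index_iota i j)) s l.

Section Descending.
Variables (G : groupType) (s : nat -> G).

Lemma desc_nil i : desc s i i = 1.
Proof. by rewrite /desc /index_iota subnn big_nil. Qed.

Lemma desc_recl i j : i <= j -> desc s i j.+1 = s j * desc s i j.
Proof.
move=> ij; rewrite /desc /index_iota subSn // -addn1 iotaD subnKC //.
by rewrite rev_cat big_cat big_seq1.
Qed.

Lemma desc_recr i j : i < j -> desc s i j = desc s i.+1 j * s i.
Proof.
move=> ij; rewrite /desc /index_iota -(subnSK ij) /= rev_cons -cats1.
by rewrite big_cat big_seq1.
Qed.

Lemma prod_inv_desc i j :
  \prod_(l <- index_iota i j) (s l)^-1 = (desc s i j)^-1.
Proof. by rewrite /desc prodgV. Qed.

End Descending.

(* The right-hand sides for a_ij^-1 a_rs a_ij: (P3) if r = i, (P2) if r = j,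
   (P4) if i < r < j and (P1) otherwise. *)
Definition pure_conj (G : groupType) (a : nat -> nat -> G) (i j s r : nat) :
    G :=
  if r == i then a i s * a j s * a i s * (a j s)^-1 * (a i s)^-1
  else if r == j then a i s * a j s * (a i s)^-1
  else if i < r < j then
    a i s * a j s * (a i s)^-1 * (a j s)^-1 * a r s
      * a j s * a i s * (a j s)^-1 * (a i s)^-1
  else a r s.

(** * Artin's action on an abstract family [A] *)

Section ArtinAction.
Variables (G : groupType) (s A : nat -> G) (N : nat).
Hypothesis act_lo : forall l, l.+1 < N -> A l ^ s l = A l * A l.+1 * (A l)^-1.
Hypothesis act_hi : forall l, l.+1 < N -> A l.+1 ^ s l = A l.
Hypothesis act_fix : forall l r, l.+1 < N -> r < N -> r != l -> r != l.+1 ->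
  A r ^ s l = A r.

Lemma desc_fix i j r : i <= j < N -> r < N -> (r < i) || (j < r) ->
  A r ^ desc s i j = A r.
Proof.
case/andP; elim: j => [|j IH].
  by rewrite leqn0 => /eqP-> _ _ _; rewrite desc_nil conjg1.
rewrite leq_eqVlt => /predU1P[-> _ _ _|ij jN rN ir].
  by rewrite desc_nil conjg1.
by rewrite desc_recl // conjgM act_fix ?IH //; lia.
Qed.

Lemma desc_top i j : i <= j < N -> A j ^ desc s i j = A i.
Proof.
case/andP; elim: j => [|j IH].
  by rewrite leqn0 => /eqP-> _; rewrite desc_nil conjg1.
rewrite leq_eqVlt => /predU1P[-> _|ij jN].
  by rewrite desc_nil conjg1.
by rewrite desc_recl // conjgM act_hi ?IH //; lia.
Qed.

(** The factors above [r] fix [A r], the factor [s r] produces [A r * A r.+1 * (A r)^-1], and the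
    remaining ones carry [A r] to [A i] and fix [A r.+1]. *)
Lemma desc_mid i j r : i <= r < j -> j < N ->
  A r ^ desc s i j = A i * A r.+1 * (A i)^-1.
Proof.
case/andP; elim: j => [|j IH] // ir rj jN.
rewrite desc_recl 1?conjgM; last lia.
have [->|rj'] := eqVneq r j.
  rewrite act_lo // !conjMg conjVg desc_top ?desc_fix //; lia.
rewrite act_fix ?IH //; lia.
Qed.

(** The conjugator is Q^-1 s_(j-1)^2 Q: pull [A r] back along Q, apply s_(j-1) twice and push
    forward along Q, which carries A_(j-1) to A_i and fixes A_j. *)
Lemma conj_pure_gen i j r : i < j < N -> r < N ->
  A r ^ ((desc s i j.-1)^-1 * s j.-1 ^+ 2 * desc s i j.-1)
  = if r == i then A i * A j * A i * (A j)^-1 * (A i)^-1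
    else if r == j then A i * A j * (A i)^-1
    else if i < r < j then
      A i * A j * (A i)^-1 * (A j)^-1 * A r * A j * A i * (A j)^-1 * (A i)^-1
    else A r.
Proof.
case: j => [|j] // ij rN /=; rewrite 2!conjgM.
set Q := desc s i j.
have EV x y : x ^ Q = y -> y ^ Q^-1 = x by move=> <-; rewrite conjgK.
have Qi : A i ^ Q^-1 = A j by apply/EV/desc_top; lia.
have Qj : A j.+1 ^ Q = A j.+1 by rewrite desc_fix //; lia.
have Qj' : A j ^ Q = A i by rewrite desc_top //; lia.
have s2 x : x ^ (s j ^+ 2) = (x ^ s j) ^ s j by rewrite conjgM.
have Sj : A j ^ (s j ^+ 2) = A j * A j.+1 * A j * (A j.+1)^-1 * (A j)^-1.
  by rewrite s2 act_lo ?conjMg ?conjVg ?act_lo ?act_hi; [gnorm|lia..].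
have Sj1 : A j.+1 ^ (s j ^+ 2) = A j * A j.+1 * (A j)^-1.
  by rewrite s2 act_hi ?act_lo //; lia.
case: eqVneq => [->|ri]; first by rewrite Qi Sj !(conjMg, conjVg) Qj Qj'.
case: eqVneq => [->|rj].
  by rewrite (EV _ _ Qj) Sj1 !(conjMg, conjVg) Qj Qj'.
case: ifP => [irj|irj].
  (* The pull-back of [A r] is A_(r-1) conjugated by [A j]. The square fixes A_(r-1) but not this
     conjugator, whence the commutators in (P4). *)
  have [r' rE] : exists r', r = r'.+1 by exists r.-1; lia.
  have Sr : A r' ^ (s j ^+ 2) = A r' by rewrite s2 !act_fix //; lia.
  have Qr : A r' ^ Q = A i * A r * (A i)^-1 by rewrite rE desc_mid //; lia.
  have -> : A r ^ Q^-1 = (A j)^-1 * A r' * A j.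
    by rewrite -Qi -(EV _ _ Qr) -conjVg -!conjMg; gnorm.
  rewrite (conjg_sandwich _ _ (s j ^+ 2)) Sj Sr !(conjMg, conjVg) Qj Qj' Qr.
  by gnorm.
have Qr : A r ^ Q = A r by rewrite desc_fix //; lia.
by rewrite (EV _ _ Qr) s2 !act_fix ?Qr //; lia.
Qed.

End ArtinAction.

(* In the braid group on three strands, x y^2 x commutes with y. *)
Lemma braid3_sqr (G : groupType) (x y : G) : x * y * x = y * x * y ->
  (y * x ^+ 2 * y^-1) ^ x
  = y * x ^+ 2 * y^-1 * y ^+ 2 * (y * x ^+ 2 * y^-1)^-1.
Proof.
move=> xyx.
have E : y * x ^+ 2 * y^-1 = x^-1 * y ^+ 2 * x.
  apply: (mulgI x); apply: (mulIg y); gnorm.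
  have -> : x * y * x * x = y * (x * y * x) by rewrite {1}xyx !mulgA.
  by rewrite xyx !mulgA.
rewrite E.
have C : x * y ^+ 2 * x * y = y * (x * y ^+ 2 * x).
  gnorm; have -> : x * y * y * x * y = x * y * (y * x * y) by rewrite !mulgA.
  by rewrite -xyx !mulgA xyx.
have C2 : (x * y ^+ 2 * x) * y ^+ 2 = y ^+ 2 * (x * y ^+ 2 * x).
  by rewrite !expgS !expg0 !mulg1 in C *; rewrite mulgA C -mulgA C mulgA.
(* After cancellation the claim reads y^2 (x y^2 x) = (x y^2 x) y^2. *)
apply: (mulgI (x ^+ 2)); apply: (mulIg (x^-1 * y ^+ 2 * x)).
have -> : x ^+ 2 * (x^-1 * y ^+ 2 * x) ^ x * (x^-1 * y ^+ 2 * x)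
    = y ^+ 2 * (x * y ^+ 2 * x) by gnorm.
by rewrite -C2; gnorm.
Qed.

(** * The braid generators acting on the elements a_ij *)

Section PureGenerators.
Variable k : nat.
Local Notation sg := (sigma k).

Lemma pure_gen_desc i j :
  pure_gen k i j = (desc sg i j.-1)^-1 * sg j.-1 ^+ 2 * desc sg i j.-1.
Proof. by rewrite /pure_gen prod_inv_desc. Qed.

Lemma pure_gen_descV i j : i < j < k ->
  pure_gen k i j = desc sg i.+1 j * sg i ^+ 2 * (desc sg i.+1 j)^-1.
Proof. by move=> ij; rewrite pure_genE // prod_inv_desc. Qed.

Lemma desc_comm i p q : (i.+1 < p) || (q < i) -> commute (sg i) (desc sg p q).
Proof.
move=> ipq; rewrite /desc big_seq.
apply: (big_ind (fun x => commute (sg i) x)) => [|x y|l].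
- exact: commute1.
- exact: commuteM.
- rewrite mem_rev mem_index_iota /commute => lpq.
  by have [il|il] := boolP (i.+1 < l); [|symmetry]; apply: sigma_comm; lia.
Qed.

(** The letters above i+1 commute with sigma_i and those below i with sigma_(i+1); what remains is a
    single braid relation. *)
Lemma desc_shift i p q : p <= i -> i.+1 < q < k ->
  desc sg p q * sg i.+1 = sg i * desc sg p q.
Proof.
move=> pi /andP[]; elim: q => [|q IH] // iq qk.
rewrite desc_recl; last lia.
have [iq'|iq'] := boolP (i.+1 < q).
  by rewrite -mulgA IH ?mulgA ?(sigma_comm k iq') //; lia.
have qE : q = i.+1 by lia.
rewrite {}qE in qk *.
rewrite desc_recl // -mulgA -(mulgA (sg i)) -desc_comm ?leqnn ?orbT //.
by rewrite !mulgA sigma_braid //; lia.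
Qed.

Section LastStrand.
Variable s : nat.
Hypothesis sk : s < k.
Local Notation A r := (pure_gen k r s).

Lemma sigma_pure_hi l : l.+1 < s -> A l.+1 ^ sg l = A l.
Proof.
move=> ls; rewrite (_ : A l = (sg l)^-1 * A l.+1 * sg l); last first.
  rewrite !pure_gen_desc (@desc_recr _ _ l); last lia.
  by gnorm.
by gnorm.
Qed.

Lemma sigma_pure_lo l : l.+1 < s -> A l ^ sg l = A l * A l.+1 * (A l)^-1.
Proof.
move=> ls; rewrite !pure_gen_descV; try lia.
(* [T] commutes with sigma_l, so the claim is the conjugate by [T^-1] of [braid3_sqr], an identity
   in sigma_l and sigma_(l+1) alone. *)
set T := desc sg l.+2 s; set T' := desc sg l.+1 s.
have -> : T' = T * sg l.+1 by rewrite /T' desc_recr.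
have cT : T ^ sg l = T.
  by apply/conjg_fixP/commgP/commute_sym/desc_comm; rewrite ltnSn.
set x := sg l; set y := sg l.+1.
have -> : T * y * x ^+ 2 * (T * y)^-1 = (y * x ^+ 2 * y^-1) ^ T^-1 by gnorm.
have -> : T * y ^+ 2 * T^-1 = (y ^+ 2) ^ T^-1 by gnorm.
rewrite -conjVg -!conjMg -braid3_sqr; last by apply: sigma_braid; lia.
by rewrite conjJg conjVg cT.
Qed.

Lemma sigma_pure_fix l r : l.+1 < s -> r < s -> r != l -> r != l.+1 ->
  A r ^ sg l = A r.
Proof.
move=> ls rs rl rl'.
have cs i : (l.+1 < i) || (i.+1 < l) -> commute (sg l) (sg i).
  by case/orP=> il; [|symmetry]; apply: sigma_comm.
apply/conjg_fixP/commgP/commute_sym.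
case: (ltnP l r) => lr.
  rewrite pure_gen_descV; last lia.
  have cD : commute (sg l) (desc sg r.+1 s) by apply: desc_comm; lia.
  apply: commuteM; last exact: commuteV.
  by apply: commuteM => //; apply/commuteX/cs; lia.
rewrite pure_gen_descV; last lia.
(* For r < l, sigma_l passes [T] and becomes sigma_(l+1), which commutes with the core sigma_r^2. *)
set T := desc _ _ _.
have TE : T * sg l.+1 = sg l * T by apply: desc_shift; lia.
have cr : commute (sg l.+1) (sg r ^+ 2).
  by apply/commuteX; symmetry; apply: sigma_comm; lia.
have TV : sg l.+1 * T^-1 = T^-1 * sg l.
  by apply: (mulgI T); rewrite mulgA TE mulgK mulVKg.
move: (sg r ^+ 2) cr => c cr.
rewrite /commute !mulgA -TE -(mulgA T (sg l.+1)) cr.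
by rewrite mulgA -mulgA TV mulgA.
Qed.

End LastStrand.

(** For fixed [s] the family a_(r,s) satisfies the hypotheses of Artin's action with N = s, and a_ij
    only involves sigma_l with l + 1 < s. *)
Lemma pure_gen_conj i j s r : i < j < s -> s < k -> r < s ->
  pure_gen k r s ^ pure_gen k i j = pure_conj (pure_gen k) i j s r.
Proof.
move=> ij sk rs; rewrite (pure_gen_desc i j).
rewrite (conj_pure_gen (A := fun r => pure_gen k r s) (N := s)) //.
- exact: sigma_pure_lo.
- exact: sigma_pure_hi.
- exact: sigma_pure_fix.
Qed.

End PureGenerators.

(** * Freeness of the generators involving the last strand *)

Section Generated.
Variable G : groupType.

Inductive gspan (S : G -> Prop) : G -> Prop :=
| gspan_in x of S x : gspan S x
| gspan1 : gspan S 1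
| gspanV x of gspan S x : gspan S x^-1
| gspanM x y of gspan S x & gspan S y : gspan S (x * y).

Lemma gspan_le (S S' : G -> Prop) x :
  (forall y, S y -> gspan S' y) -> gspan S x -> gspan S' x.
Proof.
move=> SS'; elim=> [y|| y _|y z _ IHy _]; first exact: SS'.
- exact: gspan1.
- exact: gspanV.
- exact: gspanM.
Qed.

Lemma gspan_conj (S : G -> Prop) g x :
  (forall y, S y -> gspan S (y ^ g)) -> gspan S x ->
  gspan S (x ^ g).
Proof.
move=> Sg; elim=> [y|| y _|y z _ IHy _ IHz]; first exact: Sg.
- rewrite conj1g; exact: gspan1.
- rewrite conjVg; exact: gspanV.
- rewrite conjMg; exact: gspanM.
Qed.

End Generated.

Lemma gspan_morph (G H : groupType) (f : UMagmaMorphism.type G H)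
    (S : G -> Prop) (S' : H -> Prop) x :
  (forall y, S y -> gspan S' (f y)) -> gspan S x -> gspan S' (f x).
Proof.
move=> SS'; elim=> [y|| y _|y z _ IHy _ IHz]; first exact: SS'.
- rewrite gmulf1; exact: gspan1.
- rewrite gmulfV; exact: gspanV.
- rewrite gmulfM; exact: gspanM.
Qed.

Lemma gspan_pres X (R : gexpr X -> gexpr X -> Prop) (b : pres R) :
  gspan (fun c => exists x, c = pres_gen R x) b.
Proof.
rewrite -(pres_reprK b).
elim: (generic_quotient.repr b) => [x||u IHu|u IHu v IHv].
- by apply: gspan_in; exists x.
- exact: gspan1.
- rewrite pres_classV; exact: gspanV.
- rewrite pres_classM; exact: gspanM.
Qed.

Lemma pres_morph_ext X (R : gexpr X -> gexpr X -> Prop) (G : groupType)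
    (f g : UMagmaMorphism.type (pres R) G) :
  (forall x, f (pres_gen R x) = g (pres_gen R x)) -> f =1 g.
Proof.
move=> fg b; elim: (gspan_pres b) => [_ [x ->]|| y _|y z _ IHy _ IHz] //.
- by rewrite !gmulf1.
- by move=> IH; rewrite !gmulfV IH.
- by rewrite !gmulfM IHy IHz.
Qed.

(** [T] will be an infinite set of cosets. Storing the inverse as data makes group inversion an
    exchange of fields; by [bijection_ext] it adds no information. *)
Record bijection (T : Type) := Bijection {
  bij_fun :> T -> T;
  bij_inv : T -> T;
  bij_funK : cancel bij_fun bij_inv;
  bij_invK : cancel bij_inv bij_fun }.

HB.instance Definition _ (T : Type) := gen_eqMixin (bijection T).
HB.instance Definition _ (T : Type) := gen_choiceMixin (bijection T).

Section BijectionGroup.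
Variable T : Type.
Implicit Types f g h : bijection T.

Lemma bijection_ext f g : f =1 g -> f = g.
Proof.
case: f g => [f f' fK f'K] [g g' gK g'K] /= fg.
have {}fg : f = g by apply: funext.
rewrite -{}fg in gK g'K *.
have gf : g' = f' by apply: funext => t; rewrite -{1}(f'K t) gK.
rewrite {}gf in gK g'K *; congr Bijection; exact: Prop_irrelevance.
Qed.

Definition bij_one : bijection T := @Bijection T id id (frefl _) (frefl _).
Definition bij_opp f : bijection T := Bijection (bij_invK f) (bij_funK f).
(* f * g applies f first, so that a morphism into bijections is an action on
   the right. *)
Definition bij_mul f g : bijection T :=
  Bijection (can_comp (bij_funK g) (bij_funK f))
            (can_comp (bij_invK f) (bij_invK g)).

Lemma bij_mulA : associative bij_mul.
Proof. by move=> f g h; apply: bijection_ext. Qed.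

Lemma bij_mul1 : left_id bij_one bij_mul.
Proof. by move=> f; apply: bijection_ext. Qed.

Lemma bij_mulr1 : right_id bij_one bij_mul.
Proof. by move=> f; apply: bijection_ext. Qed.

Lemma bij_mulV : left_inverse bij_one bij_opp bij_mul.
Proof. by move=> f; apply: bijection_ext => t; apply: bij_invK. Qed.

Lemma bij_mulrV : right_inverse bij_one bij_opp bij_mul.
Proof. by move=> f; apply: bijection_ext => t; apply: bij_funK. Qed.

HB.instance Definition _ := isGroup.Build (bijection T)
  bij_mulA bij_mul1 bij_mulr1 bij_mulV bij_mulrV.

Lemma bijM f g t : (f * g) t = g (f t).
Proof. by []. Qed.

Lemma bijV_eq f t t' : f t' = t -> f^-1 t = t'.
Proof. by move=> <-; apply: bij_funK. Qed.

End BijectionGroup.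

(** Infinitely many generators, so that a single group serves every number of strands. *)
Definition free_group : groupType := pres (fun _ _ : gexpr nat => False).

Definition free_gen (i : nat) : free_group := pres_gen _ i.

Section FreeLift.
Variables (G : groupType) (f : nat -> G).

Lemma free_respects : respects_relations (fun _ _ : gexpr nat => False) f.
Proof. by []. Qed.

Definition free_lift : UMagmaMorphism.type free_group G :=
  pres_lift free_respects.

Lemma free_lift_gen i : free_lift (free_gen i) = f i.
Proof. exact: pres_lift_gen. Qed.

End FreeLift.

Lemma free_morph_ext (G : groupType) (f g : UMagmaMorphism.type free_group G) :
  (forall i, f (free_gen i) = g (free_gen i)) -> f =1 g.
Proof. exact: pres_morph_ext. Qed.

Arguments free_lift : simpl never.

(** * Artin's automorphisms of the free group *)

Section ArtinRepresentation.
Local Notation x := free_gen.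

Definition artin (i : nat) : UMagmaMorphism.type free_group free_group :=
  free_lift (fun j => if j == i then x i * x i.+1 * (x i)^-1
                      else if j == i.+1 then x i else x j).

Definition artinV (i : nat) : UMagmaMorphism.type free_group free_group :=
  free_lift (fun j => if j == i then x i.+1
                      else if j == i.+1 then (x i.+1)^-1 * x i * x i.+1
                      else x j).

Lemma artin_gen i j : artin i (x j)
  = if j == i then x i * x i.+1 * (x i)^-1
    else if j == i.+1 then x i else x j.
Proof. exact: free_lift_gen. Qed.

Lemma artinV_gen i j : artinV i (x j)
  = if j == i then x i.+1
    else if j == i.+1 then (x i.+1)^-1 * x i * x i.+1 else x j.
Proof. exact: free_lift_gen. Qed.

Lemma neqSn i : (i.+1 == i) = false. Proof. lia. Qed.

Lemma artinK i : cancel (artin i) (artinV i).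
Proof.
apply: (@free_morph_ext _ (artinV i \o artin i) idfun) => j /=.
rewrite artin_gen; case: eqVneq => [->|ji].
  by rewrite !(gmulfM, gmulfV) !artinV_gen !(eqxx, neqSn); gnorm.
case: eqVneq => [->|jSi]; rewrite artinV_gen ?eqxx //.
by rewrite (negPf ji) (negPf jSi).
Qed.

Lemma artinVK i : cancel (artinV i) (artin i).
Proof.
apply: (@free_morph_ext _ (artin i \o artinV i) idfun) => j /=.
rewrite artinV_gen; case: eqVneq => [->|ji].
  by rewrite artin_gen eqxx neqSn.
case: eqVneq => [->|jSi].
  by rewrite !(gmulfM, gmulfV) !artin_gen !(eqxx, neqSn); gnorm.
by rewrite artin_gen (negPf ji) (negPf jSi).
Qed.

Lemma artin_comm i j w : i.+1 < j ->
  artin i (artin j w) = artin j (artin i w).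
Proof.
move=> ij; apply: (@free_morph_ext _ (artin i \o artin j) (artin j \o artin i)).
move=> l /=; rewrite !artin_gen.
have [->|li] := eqVneq l i.
  rewrite !(fun_if (artin _)) !(gmulfM, gmulfV) !artin_gen.
  by do ![case: eqVneq => // ?; try lia].
have [->|lSi] := eqVneq l i.+1.
  rewrite !(fun_if (artin _)) !(gmulfM, gmulfV) !artin_gen.
  by do ![case: eqVneq => // ?; try lia].
rewrite !(fun_if (artin _)) !(gmulfM, gmulfV) !artin_gen.
by do ![case: eqVneq => // ?; try lia].
Qed.

End ArtinRepresentation.

(** * The action of braids on cosets *)

Section CosetAction.
Local Notation x := free_gen.
Local Notation coset := (nat * free_group)%type.

Lemma artin_braid i w : artin i (artin i.+1 (artin i w))
  = artin i.+1 (artin i (artin i.+1 w)).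
Proof.
apply: (@free_morph_ext _ (artin i \o (artin i.+1 \o artin i))
  (artin i.+1 \o (artin i \o artin i.+1))) => l /=.
have E1 : (i.+2 == i) = false by lia.
have E2 : (i == i.+1) = false by lia.
have E3 : (i == i.+2) = false by lia.
pose E := (eqxx, neqSn, E1, E2, E3).
have [->|li] := eqVneq l i.
  by do !rewrite ?(gmulfM, gmulfV) !artin_gen ?E; gnorm.
have [->|l1] := eqVneq l i.+1.
  by do !rewrite ?(gmulfM, gmulfV) !artin_gen ?E; gnorm.
have [->|l2] := eqVneq l i.+2.
  by do !rewrite ?(gmulfM, gmulfV) !artin_gen ?E; gnorm.
by rewrite !(artin_gen, negPf li, negPf l1, negPf l2).
Qed.

(** In B_k write T_p = sigma_(k-2) ... sigma_p. The branches describe w(A) T_p sigma_i up to a left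
    factor in B_(k-1), by the identities T_p sigma_i = sigma_i T_p, T_(i+1) sigma_i = T_i, T_i
    sigma_i = A_i T_(i+1) and T_p sigma_i = sigma_(i-1) T_p, in this order. A generator that moves
    to the left across w acts on w through [artin]. *)
Definition step (i : nat) (t : coset) : coset :=
  let: (p, w) := t in
  if i.+1 < p then (p, artin i w)
  else if i.+1 == p then (i, w)
  else if i == p then (i.+1, w * x i)
  else (p, artin i.-1 w).

Definition unstep (i : nat) (t : coset) : coset :=
  let: (p, w) := t in
  if i.+1 < p then (p, artinV i w)
  else if i.+1 == p then (i, w * (x i)^-1)
  else if i == p then (i.+1, w)
  else (p, artinV i.-1 w).

Arguments step : simpl never.
Arguments artin : simpl never.

Lemma step_above i p w : i.+1 < p -> step i (p, w) = (p, artin i w).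
Proof. by rewrite /step => ->. Qed.

Lemma step_hi i w : step i (i.+1, w) = (i, w).
Proof. by rewrite /step ltnn eqxx. Qed.

Lemma step_lo i w : step i (i, w) = (i.+1, w * x i).
Proof. by rewrite /step ltnNge leqnSn neqSn eqxx. Qed.

Lemma step_below i p w : p < i -> step i (p, w) = (p, artin i.-1 w).
Proof.
by move=> pi; rewrite /step; do 3?case: ifP => [?|_]; rewrite ?ltnNge //; lia.
Qed.

Variant step_spec (i : nat) : nat -> Prop :=
| StepAbove p of i.+1 < p : step_spec i p
| StepHi : step_spec i i.+1
| StepLo : step_spec i i
| StepBelow p of p < i : step_spec i p.

Lemma stepP i p : step_spec i p.
Proof.
have [ip|pi] := ltnP i.+1 p; first exact: StepAbove.
have [->|pSi] := eqVneq p i.+1; first exact: StepHi.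
have [->|pi'] := eqVneq p i; first exact: StepLo.
by apply: StepBelow; lia.
Qed.

Lemma stepK i : cancel (step i) (unstep i).
Proof.
case=> p w; case: (stepP i p) => {p} [p ip|||p pi].
- by rewrite step_above // /unstep ip artinK.
- by rewrite step_hi /unstep ltnNge leqnSn neqSn eqxx.
- by rewrite step_lo /unstep ltnn eqxx mulgK.
- rewrite step_below // /unstep artinK.
  by do 3?case: ifP => [?|_] //; lia.
Qed.

Lemma unstepK i : cancel (unstep i) (step i).
Proof.
case=> p w; case: (stepP i p) => {p} [p ip|||p pi].
- by rewrite /unstep ip step_above // artinVK.
- by rewrite /unstep ltnn eqxx step_lo mulgVK.
- by rewrite /unstep ltnNge leqnSn neqSn eqxx step_hi.
- rewrite /unstep !ifN; try lia.
  by rewrite step_below // artinVK.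
Qed.

Definition step_bij (i : nat) : bijection coset :=
  Bijection (stepK i) (unstepK i).

Lemma step_comm i j : i.+1 < j ->
  step_bij i * step_bij j = step_bij j * step_bij i.
Proof.
move=> ij; apply: bijection_ext => -[p w] /=.
case: (stepP i p) => {p} [p ip|||p pi].
- rewrite (step_above _ ip).
  case: (stepP j p) ip => {p} [p jp ip|ip|ip|p pj ip].
  + by rewrite !step_above // (artin_comm w ij).
  + by rewrite !step_hi step_above.
  + rewrite !step_lo step_above ?gmulfM ?artin_gen; last lia.
    by rewrite !ifN //; lia.
  + by rewrite !(step_below _ pj) step_above // (@artin_comm i) //; lia.
- by rewrite step_hi !(@step_below j) ?step_hi //; lia.
- rewrite step_lo !(@step_below j) ?step_lo ?gmulfM ?artin_gen; try lia.
  by rewrite !ifN //; lia.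
- by rewrite !step_below ?(@artin_comm i.-1) //; lia.
Qed.

Lemma step_braid i : step_bij i * step_bij i.+1 * step_bij i
  = step_bij i.+1 * step_bij i * step_bij i.+1.
Proof.
apply: bijection_ext => -[p w] /=.
case: (stepP i p) => {p} [p ip|||p pi].
- case: (stepP i.+1 p) ip => {p} [p jp ip|ip|ip|p pj ip]; last lia.
  + by rewrite !step_above // artin_braid.
  + by rewrite step_above // !step_hi step_below.
  + by lia.
- by rewrite step_hi step_below //= !step_lo step_above // gmulfM artin_gen
    neqSn eqxx step_hi.
(* The two sides agree because [artin i] fixes x_i x_(i+1). *)
- rewrite !step_lo step_above // [step i.+1 (i, _)]step_below // step_lo.
  by rewrite step_lo /= !gmulfM !artin_gen neqSn !eqxx !mulgA mulgVK.
- rewrite !step_below //=; try lia.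
  by case: i pi => // i _; rewrite artin_braid.
Qed.

Lemma step_respects k :
  respects_relations (@braid_rel k) (fun i : 'I_k.-1 => step_bij i).
Proof.
move=> _ _ [] i j /=; last by move=> ->; apply: step_braid.
by case/orP=> /step_comm.
Qed.

(* The action of the braids on the right cosets of the subgroup of the braids
   that only move the first k - 1 strands. (p, w) stands for the coset of w(A)
   sigma_(k-2) ... sigma_p, with A the generators of the kernel of the removal
   of the last strand, so that this strand ends at the position p. *)
Definition coset_act (k : nat) : UMagmaMorphism.type (braid k) (bijection coset)
  := pres_lift (@step_respects k).

Lemma coset_act_sigma k i : i.+1 < k -> coset_act k (sigma k i) = step_bij i.
Proof.
move=> ik; have ik' : i < k.-1 by lia.
by rewrite (sigma_gen (Ordinal ik')); apply: pres_lift_gen.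
Qed.

(** From position s, sigma_(s-1) ... sigma_(i+1) leads to i+1 without changing the word; sigma_i^2
    appends x_i and returns to i+1; the inverse path leads back to s. *)
Lemma coset_act_pure_gen k i s w : i < s < k ->
  coset_act k (pure_gen k i s) (s, w) = (s, w * x i).
Proof.
move=> isk; rewrite pure_gen_descV //.
have D v : coset_act k (desc (sigma k) i.+1 s) (s, v) = (i.+1, v).
  case/andP: isk; elim: s => // s IH; rewrite leq_eqVlt.
  case/predU1P=> [->|iS] sk; first by rewrite desc_nil gmulf1.
  by rewrite desc_recl ?gmulfM ?bijM ?coset_act_sigma /= ?step_hi ?IH //; lia.
rewrite expgS expg1 !(gmulfM, gmulfV) !bijM D coset_act_sigma; last lia.
by rewrite /= step_hi step_lo; apply: bijV_eq; rewrite D.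
Qed.

End CosetAction.

(** Freeness in the form used below: a word in the a_(i,s) that is trivial as a braid stays trivial
    when each a_(i,s) is replaced by [a i]. Such a braid acts on the pairs (s, v) as right
    multiplication by the corresponding free word, so a trivial braid forces this word to be 1. *)
Lemma last_pure_gens_free k s (H : groupType) (a : nat -> H) (h : H) :
  s < k ->
  gspan (fun bh : braid k * H => exists2 i, i < s & bh = (pure_gen k i s, a i))
    (1, h) -> h = 1.
Proof.
move=> sk; set S := (X in gspan X).
have SP (bh : braid k * H) : gspan S bh ->
    exists w : free_group, free_lift a w = bh.2
      /\ forall v, coset_act k bh.1 (s, v) = (s, v * w).
  elim=> {bh} [_ [i is_ ->]||[b1 h1] _ [w [/= wh wb]]
    |[b1 h1] [b2 h2] _ [w1 [/= wh1 wb1]] _ [w2 [/= wh2 wb2]]].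
  - exists (free_gen i); rewrite free_lift_gen; split=> // v.
    by rewrite coset_act_pure_gen // is_.
  - by exists 1; rewrite gmulf1; split=> // v; rewrite gmulf1 mulg1.
  - exists w^-1; split=> [|v]; first by rewrite gmulfV; congr _^-1.
    by rewrite gmulfV; apply: bijV_eq; rewrite wb mulgVK.
  - exists (w1 * w2); split=> [|v]; first by rewrite gmulfM; congr (_ * _).
    by rewrite gmulfM bijM wb1 wb2 mulgA.
case/SP=> w [/= <-]; rewrite gmulf1 => /(_ 1)[].
by rewrite mul1g => <-; rewrite gmulf1.
Qed.

(** * Adding and removing strands *)

Lemma pres_ind X (R : gexpr X -> gexpr X -> Prop) (P : pres R -> Prop) :
  (forall x, P (pres_gen R x)) -> P 1 -> (forall b, P b -> P b^-1) ->
  (forall b c, P b -> P c -> P (b * c)) -> forall b, P b.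
Proof.
move=> Pg P1 PV PM b.
elim: (gspan_pres b) => // [_ [x ->] //|c _|c d _ Pc _ Pd].
- exact: PV.
- exact: PM.
Qed.

Lemma desc_morph (G H : groupType) (f : UMagmaMorphism.type G H)
    (s : nat -> G) (s' : nat -> H) i j :
  (forall l, i <= l < j -> f (s l) = s' l) -> f (desc s i j) = desc s' i j.
Proof.
move=> fs; rewrite /desc gmulf_prod !big_seq; apply: eq_bigr => l.
by rewrite mem_rev mem_index_iota; apply: fs.
Qed.

Section Permutations.
Variable k : nat.
Local Notation sg := (sigma k).

Lemma braid_permM : {morph @braid_perm k : b c / b * c}.
Proof. exact: gmulfM. Qed.

Lemma braid_perm1 : braid_perm (1 : braid k) = 1.
Proof. exact: gmulf1. Qed.

Lemma braid_permV : {morph @braid_perm k : b / b^-1}.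
Proof. exact: gmulfV. Qed.

Lemma braid_perm_sigma (i : 'I_k.-1) : braid_perm (sg i) = swap i.
Proof. by rewrite sigma_gen; apply: pres_lift_gen. Qed.

Lemma braid_perm_sigma_val i (p : 'I_k) : i.+1 < k ->
  braid_perm (sg i) p = (if p == i :> nat then i.+1
                         else if p == i.+1 :> nat then i else p) :> nat.
Proof.
move=> ik; have ik' : i < k.-1 by lia.
rewrite (braid_perm_sigma (Ordinal ik')) /swap.
case: tpermP => [->|->|] /=; rewrite ?eqxx ?neqSn // => /eqP pi /eqP pSi.
by rewrite -!val_eqE /= in pi pSi; rewrite (negPf pi) (negPf pSi).
Qed.

Lemma braid_perm_sigma2 i : braid_perm (sg i ^+ 2) = 1.
Proof.
have [ik|ik] := boolP (i < k.-1); last first.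
  by rewrite /sigma insubN // expg1n braid_perm1.
rewrite expgS expg1 braid_permM (braid_perm_sigma (Ordinal ik)).
by rewrite /swap tperm2.
Qed.

Lemma braid_perm_desc_fix p q (x : 'I_k) : q < x ->
  braid_perm (desc sg p q) x = x.
Proof.
move=> qx; rewrite /desc gmulf_prod big_seq.
apply: (big_ind (fun t : {perm 'I_k} => t x = x)) => [|s t sx tx|l].
- by rewrite perm1.
- by rewrite permM sx tx.
- rewrite mem_rev mem_index_iota => lpq; apply: val_inj => /=.
  by rewrite braid_perm_sigma_val; have := ltn_ord x; do ?case: ifP; lia.
Qed.

Lemma braid_perm_desc_top p q (x : 'I_k) : p <= q -> x = q :> nat ->
  braid_perm (desc sg p q) x = p :> nat.
Proof.
elim: q x => [|q IH] x.
  by rewrite leqn0 => /eqP-> xq; rewrite desc_nil braid_perm1 perm1.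
rewrite leq_eqVlt => /predU1P[-> xq|pq xq].
  by rewrite desc_nil braid_perm1 perm1.
rewrite desc_recl // braid_permM permM IH // braid_perm_sigma_val.
  by rewrite xq neqSn eqxx.
by rewrite -xq.
Qed.

Lemma braid_perm_pure_gen i j : braid_perm (pure_gen k i j) = 1.
Proof.
rewrite pure_gen_desc 2!braid_permM braid_perm_sigma2 mulg1.
by rewrite braid_permV mulVg.
Qed.

End Permutations.

Section KeepMorphism.
Variables k m : nat.
Implicit Types (A : {set 'I_k}) (b c : braid k).

Lemma braid_perm_class u :
  braid_perm (pres_class (@braid_rel k) u) = geval (@swap k) u.
Proof. exact: pres_liftE. Qed.

(** Removal of strands is a crossed morphism: the second factor meets the kept strands where the
    first one has brought them. *)
Lemma keepM A b c : #|A| = m -> keep_strands m A (b * c)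
  = keep_strands m A b * keep_strands m (braid_perm b @: A) c.
Proof.
move=> Am; rewrite -(pres_reprK b) -(pres_reprK c) -pres_classM.
rewrite !keep_strandsE //= braid_perm_class //.
by rewrite card_imset //; apply: perm_inj.
Qed.

Lemma keep1 A : #|A| = m -> keep_strands m A (1 : braid k) = 1.
Proof. by move=> Am; rewrite -(pres_class1 (@braid_rel k)) keep_strandsE. Qed.

Lemma keepV A b : #|A| = m -> keep_strands m A b^-1
  = (keep_strands m (braid_perm b^-1 @: A) b)^-1.
Proof.
move=> Am; rewrite -(pres_reprK b) -pres_classV braid_perm_class.
rewrite !keep_strandsE //.
by rewrite card_imset //; apply: perm_inj.
Qed.

Lemma keep_sigma A (i : 'I_k.-1) : #|A| = m -> keep_strands m A (sigma k i)
  = if (ord_lo i \in A) && (ord_hi i \in A) then sigma m (rank A i) else 1.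
Proof. by move=> Am; rewrite sigma_gen keep_strandsE. Qed.

Lemma imset_perm1 A : (1 : {perm 'I_k}) @: A = A.
Proof.
by rewrite -[RHS]imset_id; apply: eq_imset => x; rewrite perm1.
Qed.

Lemma keepM_pure A b c : #|A| = m -> braid_perm b = 1 ->
  keep_strands m A (b * c) = keep_strands m A b * keep_strands m A c.
Proof. by move=> Am b1; rewrite keepM // b1 imset_perm1. Qed.

(** Strand [j] is not kept and [D^-1] leaves it at position [j], so it takes part in both crossings
    of sigma_(j-1)^2. These disappear, and [D^-1] cancels [D]. *)
Lemma keep_pure_gen A i j : #|A| = m -> i < j < k ->
  (forall p : 'I_k, p \in A -> p != j :> nat) ->
  keep_strands m A (pure_gen k i j) = 1.
Proof.
move=> Am ij jA; rewrite pure_gen_desc; set D := desc _ _ _.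
have jk : j.-1 < k.-1 by lia.
pose l := Ordinal jk; rewrite (_ : j.-1 = l) //.
pose A' := braid_perm D^-1 @: A.
have A'm : #|A'| = m by rewrite card_imset //; apply: perm_inj.
have hiA' : ord_hi l \notin A'.
  apply/imsetP => -[p pA /(congr1 (braid_perm D))].
  rewrite braid_permV permKV braid_perm_desc_fix /=; last first.
    by rewrite /= /l /=; lia.
  by move=> pE; move/jA: pA; rewrite -pE /=; lia.
have A'2 : keep_strands m A' (sigma k l ^+ 2) = 1.
  rewrite expgS expg1 keepM // braid_perm_sigma !keep_sigma //.
    by rewrite (negPf hiA') in_swap swap_lo (negPf hiA') andbF mulg1.
  by rewrite card_imset //; apply: perm_inj.
rewrite -mulgA keepM // keepM // A'2 mul1g braid_perm_sigma2 imset_perm1.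
by rewrite -keepM // mulVg keep1.
Qed.

End KeepMorphism.

(** * The map from B_k to B_(k+1) that adds a last strand *)

Section Inclusion.
Variable k : nat.

Lemma sigmaS_respects :
  respects_relations (@braid_rel k) (fun i : 'I_k.-1 => sigma k.+1 i).
Proof.
move=> _ _ [] i j /=; first by case/orP=> /(sigma_comm k.+1) ->.
move=> ji; have := ltn_ord j; rewrite ji => ik.
by rewrite (@sigma_braid k.+1 i) //; lia.
Qed.

Definition add_strand : UMagmaMorphism.type (braid k) (braid k.+1) :=
  pres_lift sigmaS_respects.

Lemma add_strand_sigma i : i.+1 < k ->
  add_strand (sigma k i) = sigma k.+1 i.
Proof.
move=> ik; have ik' : i < k.-1 by lia.
by rewrite (sigma_gen (Ordinal ik')); apply: pres_lift_gen.
Qed.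

Lemma add_strand_pure_gen i j : i < j < k ->
  add_strand (pure_gen k i j) = pure_gen k.+1 i j.
Proof.
move=> ij; rewrite !pure_gen_desc !expgS !expg0 !mulg1 !gmulfM gmulfV.
rewrite add_strand_sigma; last lia.
have D : add_strand (desc (sigma k) i j.-1) = desc (sigma k.+1) i j.-1.
  by apply: desc_morph => l ijl; apply: add_strand_sigma; lia.
by rewrite !D.
Qed.

Local Notation widen := (@widen_ord k k.+1 (leqnSn k)).

Lemma widen_inj : injective widen.
Proof. by move=> p q /(congr1 val) /= /val_inj. Qed.

Lemma braid_perm_add_strand b p :
  braid_perm (add_strand b) (widen p) = widen (braid_perm b p).
Proof.
move: b p; apply: pres_ind => [i p||b IH p|b c IHb IHc p].
- have ik : i.+1 < k by have := ltn_ord i; lia.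
  rewrite -sigma_gen add_strand_sigma //; apply: val_inj => /=.
  by rewrite !braid_perm_sigma_val //; lia.
- by move=> p; rewrite gmulf1 !braid_perm1 !perm1.
- apply: (@perm_inj _ (braid_perm (add_strand b))).
  by rewrite IH gmulfV !braid_permV !permKV.
- by rewrite gmulfM !braid_permM !permM IHb IHc.
Qed.

Lemma keep_add_strand m (A : {set 'I_k}) b : #|A| = m ->
  keep_strands m (widen @: A) (add_strand b) = keep_strands m A b.
Proof.
move: b A; apply: pres_ind => [i A Am|A Am|b IH A Am|b c IHb IHc A Am].
- have ik : i < k by have := ltn_ord i; lia.
  have ik' : i.+1 < k by have := ltn_ord i; lia.
  rewrite -sigma_gen add_strand_sigma // keep_sigma //.
  rewrite (@keep_sigma k.+1 m _ (Ordinal ik)); last first.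
    by rewrite card_imset //; apply: widen_inj.
  have -> : ord_lo (Ordinal ik : 'I_k.+1.-1) = widen (ord_lo i).
    exact: val_inj.
  have -> : ord_hi (Ordinal ik : 'I_k.+1.-1) = widen (ord_hi i).
    exact: val_inj.
  rewrite !(mem_imset _ _ widen_inj); congr (if _ then sigma m _ else _).
  rewrite /rank -[RHS](card_imset _ widen_inj); apply: eq_card => q.
  rewrite inE; apply/andP/imsetP => [[/imsetP[p pA ->] pi]|[p + ->]].
    by exists p => //; rewrite inE pA.
  by rewrite inE => /andP[pA pi]; rewrite imset_f.
- by rewrite gmulf1 !keep1 // card_imset //; apply: widen_inj.
- rewrite gmulfV !keepV //; last by rewrite card_imset //; apply: widen_inj.
  rewrite -IH ?card_imset //; last exact: perm_inj.
  congr (keep_strands m _ _)^-1; rewrite -!imset_comp; apply: eq_imset => p.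
  by rewrite /= -gmulfV braid_perm_add_strand.
- rewrite gmulfM !keepM //; last by rewrite card_imset //; apply: widen_inj.
  rewrite IHb // -IHc ?card_imset //; last exact: perm_inj.
  congr (_ * keep_strands m _ _); rewrite -!imset_comp; apply: eq_imset => p.
  by rewrite /= braid_perm_add_strand.
Qed.

End Inclusion.

Definition first_strands (m k : nat) : {set 'I_k} :=
  [set p : 'I_k | p < m].

Lemma card_first m k : m <= k -> #|first_strands m k| = m.
Proof. by move=> /subnKC <-; apply: card_first_strands. Qed.

(** Together with [keep_first_add_strand] at m = k, this makes the removal of the last strand a left
    inverse of [add_strand]. *)
Lemma keep_all k (b : braid k) : keep_strands k (first_strands k k) b = b.
Proof.
have kT : first_strands k k = [set: 'I_k].
  by apply/setP => p; rewrite !inE ltn_ord.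
have cT : #|[set: 'I_k]| = k by rewrite -kT card_first.
have pT (s : {perm 'I_k}) : s @: [set: 'I_k] = [set: 'I_k].
  by apply/setP => p; rewrite !inE -[p](permKV s) imset_f.
rewrite kT; move: b; apply: pres_ind => [i||b IH|b c IHb IHc].
- rewrite -sigma_gen keep_sigma // !inE; congr sigma.
  rewrite /rank -[RHS](@card_first i k); last by have := ltn_ord i; lia.
  by apply: eq_card => p; rewrite !inE.
- exact: keep1.
- by rewrite keepV // pT IH.
- by rewrite keepM // pT IHb IHc.
Qed.

Lemma keep_first_add_strand m k (b : braid k) : m <= k ->
  keep_strands m (first_strands m k.+1) (add_strand k b)
  = keep_strands m (first_strands m k) b.
Proof.
move=> mk; rewrite -[RHS]keep_add_strand ?card_first //; congr keep_strands.
apply/setP => p; rewrite inE; apply/idP/imsetP => [pm|[q + ->]]; last first.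
  by rewrite inE.
have pk : p < k by lia.
by exists (Ordinal pk); [rewrite inE|apply: val_inj].
Qed.

(** * Injectivity *)

(** (P1)-(P4) in an arbitrary group, so that the braid group, the presented group and their product
    are treated alike. *)
Definition pure_relations m k (G : groupType) (a : nat -> nat -> G) : Prop :=
  forall i j s r, m <= j -> i < j < s -> s < k -> r < s ->
  a r s ^ a i j = pure_conj a i j s r.

Definition mixed_gens m k (G : groupType) (a : nat -> nat -> G) (x : G) :
    Prop :=
  exists i j, [/\ m <= j, i < j < k & x = a i j].

Definition last_gens k (G : groupType) (a : nat -> nat -> G) (x : G) : Prop :=
  exists2 i, i < k & x = a i k.

Lemma gspan_empty (G : groupType) (S : G -> Prop) x :
  (forall y, ~ S y) -> gspan S x -> x = 1.
Proof.
move=> S0; elim=> [y /S0||y _ ->|y z _ -> _ ->] //.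
- by rewrite invg1.
- by rewrite mulg1.
Qed.

Section Decomposition.
Variables (m k : nat) (G : groupType) (a : nat -> nat -> G).
Hypothesis rel_a : pure_relations m k.+1 a.
Local Notation S := (last_gens k a).

Lemma last_gens_in i : i < k -> gspan S (a i k).
Proof. by move=> ik; apply: gspan_in; exists i. Qed.

Lemma gspan_conjg (x y : G) : gspan S x -> gspan S y -> gspan S (x ^ y).
Proof.
by move=> Sx Sy; rewrite conjgE; do ?apply: gspanM => //; apply: gspanV.
Qed.

Lemma last_gens_conj i j x : m <= j -> i < j < k ->
  gspan S x -> gspan S (x ^ a i j).
Proof.
move=> mj ijk; apply: gspan_conj => _ [r rk ->].
have Si : gspan S (a i k) by apply: last_gens_in; lia.
have Sj : gspan S (a j k) by apply: last_gens_in; lia.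
have Sr := last_gens_in rk.
rewrite rel_a ?ltnSn // /pure_conj.
by do 3?case: ifP => _ //; do ?apply: gspanM => //; apply: gspanV.
Qed.

(** Stability under a_ij does not by itself give stability under its inverse. But a_ij fixes a_ik
    a_jk and acts on a_ik and a_jk as conjugation by (a_ik a_jk)^-1, so its inverse acts on these
    two as conjugation by a_ik a_jk. *)
Lemma last_gens_conjV i j x : m <= j -> i < j < k ->
  gspan S x -> gspan S (x ^ (a i j)^-1).
Proof.
move=> mj ijk; apply: gspan_conj => _ [r rk ->].
have Si : gspan S (a i k) by apply: last_gens_in; lia.
have Sj : gspan S (a j k) by apply: last_gens_in; lia.
have Sr := last_gens_in rk.
have ji : (j == i) = false by lia.
have rel t : t < k -> a t k ^ a i j = pure_conj a i j k t.
  by move=> tk; apply: rel_a; rewrite ?ltnSn.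
set g := a i j in rel *.
have Pij : (a i k * a j k) ^ g = a i k * a j k.
  by rewrite conjMg !rel /pure_conj ?eqxx ?ji; [gnorm|lia..].
have EV x' y' : x' ^ g = y' -> y' ^ g^-1 = x' by move=> <-; rewrite conjgK.
have SV t : t \in [:: i; j] -> gspan S (a t k ^ g^-1).
  move=> tij; have -> : a t k ^ g^-1 = a t k ^ (a i k * a j k).
    apply: EV; rewrite conjJg Pij rel; last by rewrite !inE in tij; lia.
    rewrite /pure_conj; rewrite !inE in tij.
    by case/orP: tij => /eqP->; rewrite ?ji eqxx; gnorm.
  apply: gspan_conjg; last exact: gspanM.
  by rewrite !inE in tij; case/orP: tij => /eqP->.
have := rel r rk; rewrite /pure_conj.
case: eqVneq => [-> _|_]; first by apply: SV; rewrite inE eqxx.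
case: eqVneq => [-> _|_]; first by apply: SV; rewrite !inE eqxx orbT.
case: ifP => _ E; last by rewrite (EV _ _ E).
(* For i < r < j, [g] acts on a_rk as conjugation by [C^-1], so its inverse acts as conjugation by
   [C ^ g^-1], a word in the two conjugates already treated. *)
pose C := a i k * a j k * (a i k)^-1 * (a j k)^-1.
have {}E : a r k ^ g = a r k ^ C^-1 by rewrite E /C; gnorm.
have -> : a r k ^ g^-1 = a r k ^ (C ^ g^-1).
  by apply: EV; rewrite conjJg conjgKV E conjgKV.
apply: gspan_conjg => //; rewrite /C !conjMg !conjVg.
have := SV i; have := SV j; rewrite !inE !eqxx orbT => /(_ isT) Tj /(_ isT) Ti.
move: (a i k ^ g^-1) (a j k ^ g^-1) Ti Tj => y z Sy Sz.
by do ?apply: gspanM => //; apply: gspanV.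
Qed.

(** The letters a_ij with j < k and their inverses normalise the span of the a_ik, so they can be
    collected on the right. *)
Lemma mixed_decomp x : gspan (mixed_gens m k.+1 a) x ->
  exists u y, [/\ gspan S u, gspan (mixed_gens m k a) y & x = u * y].
Proof.
pose D z := exists u y,
  [/\ gspan S u, gspan (mixed_gens m k a) y & z = u * y].
(* Left multiplication by [z] and by [z^-1] are handled together, so that the induction passes
   through inverses. *)
suff H (z : G) : gspan (mixed_gens m k.+1 a) z ->
    (forall d, D d -> D (z * d)) /\ (forall d, D d -> D (z^-1 * d)).
  move=> /H[D1 _]; rewrite -[x]mulg1; apply: D1; exists 1, 1.
  by split; [exact: gspan1..|rewrite mulg1].
elim=> [_ [i [j [mj ijk ->]]]||y _ [H1 H2]|y t _ [H1 H2] _ [H3 H4]].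
- have [jk|jk] := eqVneq j k.
    have Si : gspan S (a i j) by rewrite jk; apply: last_gens_in; lia.
    split=> _ [u [y [Su Py ->]]]; [exists (a i j * u)|exists ((a i j)^-1 * u)];
      exists y; split; rewrite ?mulgA //; apply: gspanM => //.
    exact: gspanV.
  have ijk' : i < j < k by lia.
  have Pij : gspan (mixed_gens m k a) (a i j).
    by apply: gspan_in; exists i, j.
  split=> _ [u [y [Su Py ->]]].
    exists (u ^ (a i j)^-1), (a i j * y); split; first exact: last_gens_conjV.
      exact: gspanM.
    by gnorm.
  exists (u ^ a i j), ((a i j)^-1 * y); split; first exact: last_gens_conj.
    by apply: gspanM => //; apply: gspanV.
  by gnorm.
- by split=> d; rewrite ?invg1 mul1g.
- by split; rewrite ?invgK.
- by split=> d Dd; rewrite ?invgM -mulgA; [apply/H1/H3|apply/H4/H2].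
Qed.

End Decomposition.

Lemma mixed_gens_pure m k b : m <= k ->
  gspan (mixed_gens m k (pure_gen k)) b ->
  braid_perm b = 1 /\ keep_strands m (first_strands m k) b = 1.
Proof.
move=> mk; have Am := card_first mk.
elim=> [_ [i [j [mj ijk ->]]]||c _ [p1 k1]|c d _ [pc kc] _ [pd kd]].
- rewrite braid_perm_pure_gen keep_pure_gen // => p; rewrite inE; lia.
- by rewrite braid_perm1 keep1.
- have pV : braid_perm c^-1 = 1 by rewrite braid_permV p1 invg1.
  by rewrite keepV // pV imset_perm1 k1 invg1.
- by rewrite braid_permM keepM // pc pd imset_perm1 kc kd !mulg1.
Qed.

Lemma pure_gen_relations m k : pure_relations m k (pure_gen k).
Proof. by move=> i j s r _ ijs sk rs; apply: pure_gen_conj. Qed.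

(** Applied to pairs, [mixed_decomp] rewrites the same word simultaneously in both groups. *)
Lemma pair_relations m k (G H : groupType) (a : nat -> nat -> G)
    (b : nat -> nat -> H) :
  pure_relations m k a -> pure_relations m k b ->
  pure_relations m k (fun i j => (a i j, b i j)).
Proof.
move=> ra rb i j s r mj ijs sk rs; have := ra i j s r mj ijs sk rs.
have := rb i j s r mj ijs sk rs; rewrite /pure_conj.
have E (x x' : G) (y y' : H) : (x, y) ^ (x', y') = (x ^ x', y ^ y') by [].
by rewrite E => -> ->; do 3?case: ifP => _ //.
Qed.

(* The subgroup generated by the pairs is the graph of a morphism sending each
   a_ij to a i j, because only 1 lies over 1. *)
Lemma mixed_graph_inj m k (H : groupType) (a : nat -> nat -> H) h :
  pure_relations m k a ->
  gspan (mixed_gens m k (fun i j => (pure_gen k i j, a i j))) (1, h) -> h = 1.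
Proof.
elim: k h => [|k IH] h ra.
  by move=> /gspan_empty E; apply: (congr1 snd (E _)) => y [i [j [_ ? _]]]; lia.
have [km|mk] := ltnP k m.
  by move=> /gspan_empty E; apply: (congr1 snd (E _)) => y [i [j [? ? _]]]; lia.
have rp := pair_relations (@pure_gen_relations m k.+1) ra.
case/(mixed_decomp rp) => -[u1 u2] [[g1 g2] [Su Sg [E1 E2]]].
(* The right factor only involves a_ij with j < k, so its braid comes from B_k, together with its
   second component. *)
have [c cE Sc] : exists2 c, g1 = add_strand k c
    & gspan (mixed_gens m k (fun i j => (pure_gen k i j, a i j))) (c, g2).
  have lift (x : braid k.+1 * H) :
      gspan (mixed_gens m k (fun i j => (pure_gen k.+1 i j, a i j))) x ->
      exists2 c, x.1 = add_strand k c
      & gspan (mixed_gens m k (fun i j => (pure_gen k i j, a i j))) (c, x.2).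
    elim=> [_ [i [j [mj ij ->]]]||[x1 x2] _ [c cE Sc]
      |[x1 x2] [y1 y2] _ [c cE Sc] _ [d dE Sd]] /=.
    - exists (pure_gen k i j); first by rewrite add_strand_pure_gen.
      by apply: gspan_in; exists i, j.
    - by exists 1; [rewrite gmulf1|apply: gspan1].
    - by exists c^-1; [rewrite gmulfV -cE|apply: gspanV Sc].
    - by exists (c * d); [rewrite gmulfM -cE -dE|apply: gspanM Sc Sd].
  exact: lift Sg.
(* With k in place of m, the mixed generators of B_(k+1) are exactly the a_ik; hence
   [mixed_gens_pure] shows that [u1] dies when the last strand is removed. *)
have Su1 : gspan (mixed_gens k k.+1 (pure_gen k.+1)) u1.
  suff /(_ _ Su) : forall x, gspan (last_gens k
      (fun i j => (pure_gen k.+1 i j, a i j))) x ->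
      gspan (mixed_gens k k.+1 (pure_gen k.+1)) x.1 by [].
  move=> x; elim=> [_ [i ik ->]||y _|y z _ Sy _ Sz].
  - by apply: gspan_in; exists i, k; rewrite leqnn ik ltnSn.
  - exact: gspan1.
  - exact: gspanV.
  - exact: gspanM Sy Sz.
have [pu ku] := mixed_gens_pure (leqnSn k) Su1.
(* Removing the last strand from 1 = u1 c leaves c. The induction hypothesis then disposes of [g2],
   and freeness of [u2]. *)
have c1 : c = 1.
  rewrite -(keep_all c) -keep_first_add_strand // -cE.
  rewrite -[LHS]mul1g -ku -keepM_pure ?card_first // -E1.
  by rewrite keep1 // card_first.
have g21 : g2 = 1.
  by apply: IH => [i j s r mj ijs sk rs|]; [apply: ra => //; lia|rewrite -c1].
have u11 : u1 = 1 by rewrite E1 cE c1 gmulf1 mulg1.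
rewrite E2 g21 mulg1; apply: (@last_pure_gens_free k.+1 k _ (a ^~ k)) => //.
by rewrite -u11.
Qed.

(** * Generation *)

Section CosetDecomposition.
Variable k : nat.
Local Notation U := (gspan (last_gens k (pure_gen k.+1))).
Local Notation T p := (desc (sigma k.+1) p k).

Lemma sigma_last_gens l u : l.+1 < k ->
  U u -> U (u ^ sigma k.+1 l) /\ U (u ^ (sigma k.+1 l)^-1).
Proof.
move=> lk Uu; set s := sigma k.+1 l; pose A r := pure_gen k.+1 r k.
have UA r : r < k -> U (A r) by move=> rk; apply: gspan_in; exists r.
have hi : A l.+1 ^ s = A l by apply: sigma_pure_hi.
have lo : A l ^ s = A l * A l.+1 * (A l)^-1 by apply: sigma_pure_lo.
have fx r : r < k -> r != l -> r != l.+1 -> A r ^ s = A r.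
  by move=> rk rl rSl; apply: sigma_pure_fix.
have Ul : U (A l) by apply: UA; lia.
have Ul1 : U (A l.+1) by apply: UA.
have EV x y : x ^ s = y -> y ^ s^-1 = x by move=> <-; rewrite conjgK.
split; apply: gspan_conj Uu => _ [r rk ->]; rewrite -/(A r).
- have [->|rl] := eqVneq r l.
    by rewrite lo; do ?apply: gspanM => //; apply: gspanV.
  have [->|rSl] := eqVneq r l.+1; first by rewrite hi.
  by rewrite fx //; apply: UA.
- have [->|rl] := eqVneq r l; first by rewrite (EV _ _ hi).
  have [->|rSl] := eqVneq r l.+1; last first.
    by rewrite (EV _ _ (fx _ _ _ _)) //; apply: UA.
  have -> : A l.+1 ^ s^-1 = (A l.+1)^-1 * A l * A l.+1.
    apply: EV; rewrite conjg_sandwich hi lo.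
    by move: (A l) (A l.+1) => y z; gnorm.
  by do ?apply: gspanM => //; apply: gspanV.
Qed.

Lemma add_strand_last_gens c u :
  U u -> U (u ^ add_strand k c) /\ U (u ^ (add_strand k c)^-1).
Proof.
move: c u; apply: pres_ind => [i u Uu|u Uu|c IH u /IH[]|c d IHc IHd u Uu].
- have ik : i.+1 < k by have := ltn_ord i; lia.
  by rewrite -sigma_gen add_strand_sigma //; apply: sigma_last_gens.
- by rewrite gmulf1 invg1 !conjg1.
- by rewrite gmulfV invgK.
- rewrite gmulfM invgM !conjgM; split.
    by have [+ _] := IHc _ Uu => /IHd[].
  by have [_ +] := IHd _ Uu => /IHc[].
Qed.

(** [p] is the position where the last strand of [b] ends, since the first two factors return it to
    its place. *)
Definition coset_form (b : braid k.+1) : Prop :=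
  exists u c p, [/\ U u, p <= k & b = u * add_strand k c * T p].

Lemma coset_form_mull u c p v : U u -> p <= k -> U v ->
  coset_form (u * add_strand k c * (v * T p)).
Proof.
move=> Uu pk Uv; exists (u * v ^ (add_strand k c)^-1), c, p; split=> //.
  by apply: gspanM => //; have [] := add_strand_last_gens c Uv.
by gnorm.
Qed.

Lemma coset_form_mulr u c p i : U u -> p <= k -> i.+1 < k ->
  coset_form (u * add_strand k c * (sigma k.+1 i * T p))
  /\ coset_form (u * add_strand k c * ((sigma k.+1 i)^-1 * T p)).
Proof.
move=> Uu pk ik; split; [exists u, (c * sigma k i), p|
  exists u, (c * (sigma k i)^-1), p]; split=> //.
  by rewrite gmulfM add_strand_sigma // !mulgA.
by rewrite gmulfM gmulfV add_strand_sigma // !mulgA.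
Qed.

(** The four cases of [step], now as identities in the braid group, and likewise for the inverse of
    sigma_i. *)
Lemma coset_form_sigma b i : i < k -> coset_form b ->
  coset_form (b * sigma k.+1 i) /\ coset_form (b * (sigma k.+1 i)^-1).
Proof.
move=> ik [u [c [p [Uu pk ->]]]]; rewrite -!(mulgA _ (T p)).
have EV (s s' : braid k.+1) : T p * s = s' * T p -> T p * s^-1 = s'^-1 * T p.
  by move=> E; rewrite -(mulKg s' (T p * s^-1)) (mulgA s') -E mulgK.
have UA : U (pure_gen k.+1 i k) by apply: gspan_in; exists i.
have AE : pure_gen k.+1 i k = T i.+1 * sigma k.+1 i ^+ 2 * (T i.+1)^-1.
  by rewrite pure_gen_descV // ik ltnSn.
have TE : T i = T i.+1 * sigma k.+1 i by apply: desc_recr.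
case: (stepP i p) pk EV => {p} [p ip|||p pi] pk EV.
- have cT : T p * sigma k.+1 i = sigma k.+1 i * T p.
    by rewrite desc_comm // ip.
  by rewrite (EV _ _ cT) cT; apply: coset_form_mulr => //; lia.
- split; first by exists u, c, i; rewrite TE (ltnW ik).
  have -> : T i.+1 * (sigma k.+1 i)^-1 = (pure_gen k.+1 i k)^-1 * T i.
    by rewrite AE TE; gnorm.
  by apply: coset_form_mull => //; [exact: ltnW|exact: gspanV].
- have -> : T i * sigma k.+1 i = pure_gen k.+1 i k * T i.+1.
    by rewrite AE TE; gnorm.
  have -> : T i * (sigma k.+1 i)^-1 = T i.+1 by rewrite TE mulgK.
  by split; [apply: coset_form_mull|exists u, c, i.+1].
- case: i pi {UA AE TE} ik => // i pi ik.
  have sT : T p * sigma k.+1 i.+1 = sigma k.+1 i * T p.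
    by apply: desc_shift; [exact: pi|rewrite ik ltnSn].
  by rewrite (EV _ _ sT) sT; apply: coset_form_mulr.
Qed.

Lemma coset_formP b : coset_form b.
Proof.
suff H (c : braid k.+1) : (forall b, coset_form b -> coset_form (b * c))
    /\ (forall b, coset_form b -> coset_form (b * c^-1)).
  rewrite -[b]mul1g; apply: (H b).1; exists 1, 1, k; split=> //.
    exact: gspan1.
  by rewrite gmulf1 desc_nil !mulg1.
move: c; apply: pres_ind => [i||c [H1 H2]|c d [H1 H2] [H3 H4]].
- have ik : i < k by have := ltn_ord i.
  by rewrite -sigma_gen; split=> c /(coset_form_sigma ik)[].
- by split=> c; rewrite ?invg1 mulg1.
- by rewrite invgK.
- by split=> b' /[dup] Db; rewrite ?invgM mulgA => _; [apply/H3/H1|apply/H2/H4].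
Qed.

End CosetDecomposition.

Lemma braid_perm_add_strand_last k (c : braid k) :
  braid_perm (add_strand k c) ord_max = ord_max.
Proof.
move: c; apply: pres_ind => [i||c IH|c d IHc IHd].
- have ik : i.+1 < k by have := ltn_ord i; lia.
  rewrite -sigma_gen add_strand_sigma //; apply: val_inj => /=.
  by rewrite braid_perm_sigma_val /=; do ?case: ifP; lia.
- by rewrite gmulf1 braid_perm1 perm1.
- by rewrite gmulfV braid_permV -{1}IH permK.
- by rewrite gmulfM braid_permM permM IHc IHd.
Qed.

(** The last strand of b = u c T_p ends at p, so purity makes T_p trivial. As u is pure and vanishes
    on removal, c satisfies the same hypotheses with one strand fewer. *)
Lemma mixed_gens_generate m k (b : braid k) : m <= k ->
  braid_perm b = 1 -> keep_strands m (first_strands m k) b = 1 ->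
  gspan (mixed_gens m k (pure_gen k)) b.
Proof.
elim: k b => [|k IH] b mk pb kb.
  move: mk kb; rewrite leqn0 => /eqP-> kb.
  by rewrite -(keep_all b) kb; apply: gspan1.
(* If m is the total number of strands, nothing is removed and [kb] says that [b] itself is 1. *)
move: mk; rewrite leq_eqVlt => /predU1P[mE|]; last rewrite ltnS => mk.
  by subst m; rewrite -(keep_all b) kb; apply: gspan1.
have [u [c [p [Uu pk bE]]]] := coset_formP b.
have Su j : j <= k -> gspan (mixed_gens j k.+1 (pure_gen k.+1)) u.
  move=> jk; apply: gspan_le Uu => _ [i ik ->].
  by apply: gspan_in; exists i, k; rewrite jk ik ltnSn.
have [pu ku] := mixed_gens_pure (leqW mk) (Su m mk).
have pE : p = k.
  have := braid_perm_desc_top pk (erefl : (ord_max : 'I_k.+1) = k :> nat).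
  have <- : braid_perm b ord_max
      = braid_perm (desc (sigma k.+1) p k) ord_max.
    by rewrite bE !braid_permM pu mul1g permM braid_perm_add_strand_last.
  by rewrite pb perm1 => <-.
move: bE; rewrite {}pE desc_nil mulg1 => bE.
have pc : braid_perm c = 1.
  apply/permP => q; apply: (@widen_inj k).
  rewrite -braid_perm_add_strand -[braid_perm (add_strand k c)]mul1g -pu.
  by rewrite -braid_permM -bE pb !perm1.
have kc : keep_strands m (first_strands m k) c = 1.
  rewrite -keep_first_add_strand // -[LHS]mul1g -{1}ku.
  by rewrite -keepM_pure ?card_first ?(leqW mk) // -bE.
rewrite bE; apply: gspanM; first exact: Su.
apply: gspan_morph (IH _ mk pc kc) => _ [i [j [mj ij ->]]].
rewrite add_strand_pure_gen //; apply: gspan_in; exists i, j.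
by split=> //; lia.
Qed.

(** * The presented group and its map to the braid group *)

Section MixedPresentation.
Variables m n : nat.
Local Notation k := (m + n).

Lemma mixed_indexP i j : m <= j -> i < j < k ->
  exists (i' j' : 'I_k) (ij : is_mixed_index (i', j')),
    i = i' /\ j = j'.
Proof.
move=> mj /andP[ij jk]; exists (Ordinal (ltn_trans ij jk)), (Ordinal jk).
have ij' : is_mixed_index (Ordinal (ltn_trans ij jk), Ordinal jk).
  by rewrite /is_mixed_index /= ij.
by exists ij'.
Qed.

Lemma mixed_gen_respects : respects_relations (@mixed_rel m n) (@mixed_gen m n).
Proof.
have E (i j s r : 'I_k) : i < j < s -> r < s ->
    (pure_gen k i j)^-1 * pure_gen k r s * pure_gen k i j
    = pure_conj (pure_gen k) i j s r.
  by move=> ijs rs; rewrite -mulgA -conjgE pure_gen_conj.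
move=> _ _ []; rewrite /= /mixed_gen /=.
- move=> i j r s ij rs H; rewrite E ?/pure_conj; try lia.
  by rewrite !ifN //; lia.
- move=> i j s ij js is_ H; rewrite E // /pure_conj; last lia.
  by rewrite ifN ?eqxx //; lia.
- move=> i j s ij js is_ H; rewrite E // /pure_conj ?eqxx //.
  by case/andP: H; apply: ltn_trans.
- move=> i j r s ij rs is_ js H; rewrite E ?/pure_conj; try lia.
  by rewrite 2?ifN ?ifT //; lia.
Qed.

Local Notation P := (pres (@mixed_rel m n)).

(* Extended by 1 to the pairs of numbers that are not indices. *)
Definition mixed_letter_class (i j : nat) : P :=
  if (insub i, insub j) is (Some i', Some j') then
    if insub (i', j') is Some p then pres_gen (@mixed_rel m n) p else 1
  else 1.

Lemma mixed_letter_classE (i j : 'I_k) (ij : is_mixed_index (i, j)) :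
  mixed_letter_class i j = pres_class (@mixed_rel m n) (mixed_letter ij).
Proof. by rewrite /mixed_letter_class !valK insubT. Qed.

(** Each branch of [pure_conj] is one constructor of [mixed_rel]; the last branch leaves r < i or j
    < r, the two forms of (P1). *)
Lemma mixed_letter_relations : pure_relations m k mixed_letter_class.
Proof.
move=> i j s r mj /andP[ij js] sk rs; have ms : m <= s by lia.
have ijk : i < j < m + n by lia.
have rsk : r < s < m + n by lia.
have [i' [j' [ij' [iE jE]]]] := mixed_indexP mj ijk.
have [r' [s' [rs' [rE sE]]]] := mixed_indexP ms rsk.
subst i j r s.
have is_ : is_mixed_index (i', s') by rewrite /is_mixed_index /=; lia.
have js_ : is_mixed_index (j', s') by rewrite /is_mixed_index /=; lia.
have R u v : mixed_rel u v ->
  pres_class (@mixed_rel m n) u = pres_class (@mixed_rel m n) v.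
  by move=> uv; apply/pres_class_eq/pres_rel.
rewrite conjgE mulgA /pure_conj.
case: eqVneq => [/val_inj ri|ri].
  subst r'; rewrite !mixed_letter_classE.
  rewrite -!(pres_classM, pres_classV); apply: R; apply: mixed_rel3; lia.
case: eqVneq => [/val_inj rj|rj].
  subst r'; rewrite !mixed_letter_classE.
  rewrite -!(pres_classM, pres_classV); apply: R; apply: mixed_rel2; lia.
case: ifP => irj; rewrite !mixed_letter_classE -!(pres_classM, pres_classV).
  by apply: R; apply: mixed_rel4; lia.
by apply: R; apply: mixed_rel1; lia.
Qed.

End MixedPresentation.

Theorem theorem1 (m n : nat) (hm : 0 < m) (hn : 0 < n) :
  has_presentation (mixed_pure_braid m n) (@mixed_gen m n) (@mixed_rel m n).
Proof.
pose f : UMagmaMorphism.type (pres (@mixed_rel m n)) (braid (m + n)) :=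
  pres_lift (@mixed_gen_respects m n).
have fE p : f (pres_gen _ p) = mixed_gen p by apply: pres_lift_gen.
exists f; split=> // [x y fxy|].
  pose S := mixed_gens m (m + n)
    (fun i j => (pure_gen (m + n) i j, @mixed_letter_class m n i j)).
  (* The graph of [f] lies in the subgroup generated by the pairs (a_ij, letter), so
     [mixed_graph_inj], with the presented group as target, says that the kernel of [f] is
     trivial. *)
  have fS z : gspan S (f z, z).
    move: z; apply: pres_ind => [[[i j] ij]||z Sz|z t Sz St].
    - apply: gspan_in; exists i, j; case/andP: (ij) => /= lt_ij mj.
      by rewrite mj lt_ij ltn_ord fE mixed_letter_classE.
    - by rewrite gmulf1; apply: gspan1.
    - by rewrite gmulfV; apply: gspanV Sz.
    - by rewrite gmulfM; apply: gspanM Sz St.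
  have := fS (x * y^-1); rewrite gmulfM gmulfV fxy mulgV.
  move=> /(mixed_graph_inj (@mixed_letter_relations m n)) xy.
  by rewrite -[x](mulgVK y) xy mul1g.
apply/seteqP; split=> [_ [x _ <-]|b [[_ kb] pb]].
  suff /(mixed_gens_pure (leq_addr n m))[pf kf] :
      gspan (mixed_gens m (m + n) (pure_gen (m + n))) (f x).
    by split=> //; split=> // p _; rewrite pf perm1.
  move: x; apply: pres_ind => [[[i j] ij]||z Sz|z t Sz St].
  - apply: gspan_in; exists i, j; case/andP: (ij) => /= lt_ij mj.
    by rewrite mj lt_ij ltn_ord fE.
  - by rewrite gmulf1; apply: gspan1.
  - by rewrite gmulfV; apply: gspanV Sz.
  - by rewrite gmulfM; apply: gspanM Sz St.
elim: (mixed_gens_generate (leq_addr n m) pb kb)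
  => [_ [i [j [mj ij ->]]]||c _ [x _ <-]|c d _ [x _ <-] _ [y _ <-]].
- have [i' [j' [ij' [-> ->]]]] := mixed_indexP mj ij.
  by exists (pres_gen _ (exist _ (i', j') ij')).
- by exists 1; rewrite ?gmulf1.
- by exists x^-1; rewrite ?gmulfV.
- by exists (x * y); rewrite ?gmulfM.
Qed.
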